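(* For every positive integer $k$ there is a number $f(k)$ such that if $n \ge f(k)$ and $\sigma$ is a permutation in the symmetric group $S_n$ with $\mathrm{cyc}(\sigma) \le k$, then $(\sigma^{S_n})^2 = A_n$. Moreover, there is an absolute constant $c$ such that if $n \ge c$ and $\sigma\in S_n$ is a permutation with $\mathrm{cyc}(\sigma) \le n^{1/128}$, then $(\sigma^{S_n})^2 = A_n$.
   Context: $\mathrm{cyc}(\sigma)$ denotes the number of cycles of the permutation $\sigma\in S_n$ on $\{1,\dots,n\}$, including cycles of length $1$. $\sigma^{S_n}$ is the conjugacy class of $\sigma$ in $S_n$. For a subset $A$ of a group, $A^2 = \{ab : a,b\in A\}$. $A_n$ is the alternating group. *)

(* Defs.v *)
From mathcomp Require Import all_boot all_order all_algebra.
From mathcomp Require Import all_fingroup all_solvable all_field.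

Set Implicit Arguments.
Unset Strict Implicit.
Unset Printing Implicit Defensive.

(* [porbits] includes the singleton orbits, so fixed points count as cycles. *)
Definition cyc (n : nat) (s : 'S_n) : nat := #|porbits s|.

Definition conj_class (n : nat) (s : 'S_n) : {set 'S_n} :=
  (s ^: 'Sym_('I_n))%g.

(* Main.v *)
Require Import Defs.
From mathcomp Require Import all_boot all_order all_algebra.
From mathcomp Require Import all_fingroup all_solvable all_field.
Import GRing.Theory Num.Theory.
From mathcomp Require Import zify ring.

(* To write an even t as a product of two conjugates of s we look for a conjugate
   u of t such that s * u is conjugate to s. Starting from u = 1, multiply u
   by transpositions (x y) with x and y in different orbits of u: the two
   orbits of u merge, while the cycles of s * u through x and y are joined or split.
   - Two such steps merge three orbits of u meeting one cycle of s * u without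
     changing the support of that cycle; similarly four orbits can be merged into two
     pairs. So inside a single cycle, orbits of any prescribed sizes can be built from
     fixed points of u, up to a parity condition.
   - A few transpositions between the longest cycle B of s and another cycle A give
     any prescribed number c of 2-point orbits of u meeting both A and B, while
     s * u keeps its cycle type. Choosing c corrects the parity in A and lets
     parts of t straddle A and B.
   - With k cycles and n >= C k^4 the parts of t can be distributed over the cycles
     greedily: parts that are too large are first cut into an odd number of pieces, each
     of which keeps a point in B and is glued back at the end.
   This gives the theorem whenever n >= 250000 k^4. *)

Set Implicit Arguments.
Unset Strict Implicit.
Unset Printing Implicit Defensive.

(** * Cycle lists of a permutation *)

(** The search for [u] suffices because [s^-1] has the cycle type of [s]: [u = s^-1 * (s * u)] is
    then a product of two conjugates of [s], and so is its conjugate [t]. The obstacle is parity.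
    Each transposition removes one orbit of [u] and changes the number of cycles of [s * u] by one,
    so work inside one cycle removes orbits in pairs: whole parts can fill a cycle of length [a]
    only if their number has the parity of [a]. No choice of parts may achieve this, say for odd [a]
    and only even parts. A crossing orbit therefore takes an odd number of points from the short
    cycle: one comes with its first transposition, an even number remains to be added there, and odd
    remainders are passed on to [B], where points are plentiful and the parity is right because [t]
    is even. The bound: pieces have between [L = 40 k] and [3 L] points. Each of the fewer than [k]
    short cycles may use about [6 L] crossing orbits of size 2, completed to parts or pieces of at
    most [3 L] points. These [18 k L^2] points should fit into an eighth of [B], which asks for
    about [230400 k^3] points in [B]. *)

Lemma uniq_flatten_mem (T : eqType) (ss : seq (seq T)) l :
  uniq (flatten ss) -> l \in ss -> uniq l.
Proof.
by elim: ss => //= m ss IH; rewrite cat_uniq inE => /and3P[um _ us] /predU1P[->|/(IH us)].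
Qed.

Section CycleRepresentations.
Variable T : finType.
Implicit Types (s t : {perm T}) (x y z : T) (A B l : seq T) (ss : seq (seq T)).

Definition cycrep s ss :=
  [&& perm_eq (flatten ss) (enum T), [::] \notin ss & all (fcycle s) ss].

Definition supp l : {set T} := [set z in l].

Lemma cycrep_perm s ss ss' : perm_eq ss ss' -> cycrep s ss = cycrep s ss'.
Proof.
move=> p; rewrite /cycrep (perm_all _ p) (perm_mem p); congr [&& _, _ & _].
by apply/idP/idP; apply: perm_trans; rewrite perm_flatten // perm_sym.
Qed.

Lemma cycrep_uniq s ss : cycrep s ss -> uniq (flatten ss).
Proof. by case/and3P=> p _ _; rewrite (perm_uniq p) enum_uniq. Qed.

Lemma cycrep_mem s ss x : cycrep s ss -> x \in flatten ss.
Proof. by case/and3P=> p _ _; rewrite (perm_mem p) mem_enum. Qed.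

Lemma cycrep_rot s l l' ss : l =i l' -> uniq l' -> fcycle s l' ->
  cycrep s (l :: ss) -> cycrep s (l' :: ss).
Proof.
move=> e u f rep; have ul : uniq l.
  by have := cycrep_uniq rep; rewrite /= cat_uniq; case/andP.
case/and3P: rep => p n a; apply/and3P; split.
- apply: perm_trans p; rewrite /= perm_cat2r; apply: uniq_perm => // z; exact/esym.
- move: n; rewrite !inE !negb_or => /andP[n ->]; rewrite andbT.
  apply: contraNneq n => e'; apply/eqP/esym/size0nil.
  by have /perm_size -> : perm_eq l l'; [exact: uniq_perm | rewrite -e'].
- by move: a => /= /andP[_ ->]; rewrite f.
Qed.

Lemma cycrep_catC s A B ss : cycrep s ((A ++ B) :: ss) -> cycrep s ((B ++ A) :: ss).
Proof.
move=> r; apply: (cycrep_rot _ _ _ r) => [z||].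
- by rewrite !mem_cat orbC.
- rewrite uniq_catC; have : uniq ((A ++ B) ++ flatten ss) := cycrep_uniq r.
  by rewrite (cat_uniq (A ++ B)) => /and3P[].
- by case/and3P: r => _ _ /andP[f _]; rewrite -(rot_size_cat A B) rot_cycle; move: f.
Qed.

(** * Effect of a transposition on the cycles *)

Lemma path_tperm s x y u A : x \notin A -> y \notin A ->
  path (frel (s * tperm x y)%g) u A = path (frel s) u A.
Proof.
elim: A u => //= z A IH u; rewrite !inE !negb_or => /andP[xz xA] /andP[yz yA].
rewrite IH //; congr andb; rewrite /= permM; have tz : tperm x y z = z by rewrite tpermD.
by rewrite -[in LHS]tz (inj_eq (@perm_inj _ (tperm x y))).
Qed.

Lemma fcycle_cons s x A : fcycle s (x :: A) = path (frel s) x A && (s (last x A) == x).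
Proof. by rewrite /= rcons_path. Qed.

(** [s] and [s * tperm x y] differ only at the predecessors of [x] and [y], whose images are
    exchanged; so each of the two arcs closes up. *)
Lemma fcycle_tperm2 s x y A B : uniq (x :: A ++ y :: B) ->
  fcycle s (x :: A ++ y :: B) =
  fcycle (s * tperm x y)%g (x :: A) && fcycle (s * tperm x y)%g (y :: B).
Proof.
rewrite /= cat_uniq mem_cat inE !negb_or /= ?negb_or => /andP[/and3P[xA xy xB] /and3P[uA /andP[yA _] /andP[yB uB]]].
rewrite !rcons_path cat_path /= last_cat /= !path_tperm // !permM.
have E u v w : (tperm u v (s w) == u) = (s w == v).
  by rewrite -(inj_eq (@perm_inj _ (tperm u v))) tpermK tpermL.
by rewrite E tpermC E -!andbA; do !bool_congr.
Qed.

Lemma fcycle_tperm1 s x y l : x \notin l -> y \notin l ->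
  fcycle (s * tperm x y)%g l = fcycle s l.
Proof.
case: l => // z l; rewrite !inE !negb_or => /andP[xz xA] /andP[yz yA].
by rewrite /= path_tperm // mem_rcons inE negb_or ?xz ?yz.
Qed.

Lemma cyc_split s x y A B ss : cycrep s ((x :: A ++ y :: B) :: ss) ->
  cycrep (s * tperm x y)%g ((x :: A) :: (y :: B) :: ss).
Proof.
move=> r; have u := cycrep_uniq r; case/and3P: r => p n /andP[f a].
apply/and3P; split; first by move: p; rewrite /= -!catA.
  by move: n; rewrite !inE.
move: u; rewrite [flatten _]/= -cat_cons cat_uniq => /and3P[u1 d _].
rewrite /all -/(all _ _) andbA -fcycle_tperm2 // f /=.
apply/allP => l ls; rewrite fcycle_tperm1 ?(allP a) //; apply: contra d => h; apply/hasP.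
  by exists x; rewrite ?mem_head //; apply/flattenP; exists l.
exists y; last by rewrite -cat_cons mem_cat mem_head orbT.
by apply/flattenP; exists l.
Qed.

Lemma cyc_join s x y A B ss : cycrep s ((x :: A) :: (y :: B) :: ss) ->
  cycrep (s * tperm x y)%g ((x :: A ++ y :: B) :: ss).
Proof.
move=> r; have u := cycrep_uniq r; case/and3P: r => p n /and3P[f1 f2 a].
have {u} : uniq ((x :: A ++ y :: B) ++ flatten ss) by move: u; rewrite /= -!catA.
rewrite cat_uniq => /and3P[u1 d _].
apply/and3P; split; first by move: p; rewrite /= -!catA.
  by move: n; rewrite !inE.
apply/andP; split.
  (* A transposition is an involution, so joining is splitting read backwards. *)
  by rewrite fcycle_tperm2 // -mulgA tperm2 mulg1 f1.
apply/allP => l ls; rewrite fcycle_tperm1 ?(allP a) //; apply: contra d => h; apply/hasP.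
  by exists x; rewrite ?mem_head //; apply/flattenP; exists l.
exists y; last by rewrite -cat_cons mem_cat mem_head orbT.
by apply/flattenP; exists l.
Qed.

Lemma cycrep_exists s : exists2 ss, cycrep s ss & size ss = #|porbits s|.
Proof.
have repr X : X \in porbits s -> exists x, X == porbit s x.
  by case/imsetP=> x _ ->; exists x.
pose f X := if [pick x | X == porbit s x] is Some x then traject s x #|X| else [::].
have fP X : X \in porbits s -> exists2 x, X = porbit s x & f X = traject s x #|porbit s x|.
  move=> /repr [y yP]; rewrite /f; case: pickP => [x /eqP xE|/(_ y)]; last by rewrite yP.
  by exists x; rewrite -?xE.
have fE X : X \in porbits s -> f X =i X.
  by move=> /fP[x -> ->] z; rewrite porbit_traject.
exists [seq f X | X <- enum (porbits s)]; last by rewrite size_map -cardE.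
apply/and3P; split.
- apply: uniq_perm; rewrite ?enum_uniq //; last first.
    move=> x; rewrite mem_enum; apply/flattenP; exists (f (porbit s x)).
      by apply: map_f; rewrite mem_enum imset_f.
    by rewrite fE ?imset_f // porbit_id.
  have: {subset enum (porbits s) <= porbits s} by move=> X; rewrite mem_enum.
  elim: (enum _) (enum_uniq (porbits s)) => //= X L IH /andP[XL uL] sub.
  have XP : X \in porbits s by apply: sub; exact: mem_head.
  have sub' : {subset L <= porbits s} by move=> Y YL; apply: sub; rewrite inE YL orbT.
  rewrite cat_uniq IH // andbT; apply/andP; split.
    by have [x _ ->] := fP X XP; rewrite uniq_traject_porbit.
  apply: contra XL => /hasP[z /flattenP[_ /mapP[Y YL ->]]].
  have := sub' Y YL => YP; rewrite !fE // => zY zX.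
  suff -> : X = Y by [].
  case/imsetP: XP zX => x _ ->; case/imsetP: YP zY => y _ ->.
  by rewrite -!eq_porbit_mem => /eqP<- /eqP<-.
- apply/mapP=> [[X]]; rewrite mem_enum => XP; have [x _ ->] := fP X XP.
  by have := card_porbit_neq0 s x; case: #|_|.
- apply/allP => l /mapP[X]; rewrite mem_enum => /fP[x _ ->] ->.
  have := iter_porbit s x; have := card_porbit_neq0 s x; case: #|_| => // m _ e.
  by rewrite trajectS fcycle_cons fpath_traject last_traject -iterS e eqxx.
Qed.

Lemma porbit_cycle s l x : x \in l -> fcycle s l -> uniq l -> porbit s x = supp l.
Proof.
move=> xl f u; apply/setP=> y; rewrite inE -(fconnect_cycle f xl).
apply/porbitP/idP => [[i ->]|/iter_findex <-].
  by rewrite permX fconnect_iter.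
by exists (findex s x y); rewrite permX.
Qed.

Lemma cycrep_porbits s ss : cycrep s ss -> perm_eq (map supp ss) (enum (porbits s)).
Proof.
move=> r; have u := cycrep_uniq r; have [p n a] := and3P r.
have h l : l \in ss -> exists2 x, x \in l & porbit s x = supp l.
  move=> ls; case El: l ls => [|x m] ls; first by rewrite ls in n.
  exists x; rewrite ?mem_head //; apply: porbit_cycle; rewrite ?mem_head ?(allP a) //.
  exact: uniq_flatten_mem ls.
apply: uniq_perm; rewrite ?enum_uniq //.
  rewrite map_inj_in_uniq.
    elim: ss {a p r h} u n => //= l ss IH; rewrite cat_uniq inE negb_or => /and3P[ul d us] /andP[n0 n1].
    rewrite IH // andbT; apply: contra d => ls; apply/hasP.
    by case: l ls n0 {ul} => // x l ls _; exists x; rewrite ?mem_head //; apply/flattenP; exists (x :: l); rewrite ?mem_head.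
  move=> l l' ls ls' e; have [x xl _] := h l ls.
  have xl' : x \in l' by move/setP/(_ x): e; rewrite !inE xl.
  elim: ss u ls ls' {h r p n a} => //= m ss IH; rewrite cat_uniq !inE => /and3P[um d us].
  have aux k : k \in ss -> x \in k -> x \in m -> False.
    move=> ks xk xm; move/hasP: d; apply; exists x => //; by apply/flattenP; exists k.
  case/predU1P => [lE|ls]; case/predU1P => [lE'|ls']; subst=> //.
  - by case: (aux l').
  - by case: (aux l).
  - exact: IH.
move=> X; rewrite mem_enum; apply/mapP/imsetP => [[l ls ->]|[x _ ->]].
  by have [x _ <-] := h l ls; exists x.
have := cycrep_mem x r => /flattenP[l ls xl]; exists l => //.
apply: porbit_cycle => //; first exact: (allP a).
exact: uniq_flatten_mem ls.
Qed.

Lemma cycrep_size s ss : cycrep s ss -> #|porbits s| = size ss.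
Proof. by move/cycrep_porbits/perm_size; rewrite size_map -cardE. Qed.

Lemma cycrep_odd s ss : cycrep s ss -> odd_perm s = odd #|T| (+) odd (size ss).
Proof. by move=> r; rewrite /odd_perm (cycrep_size r). Qed.

End CycleRepresentations.
Arguments supp {T} l.

(** Lets a reordering of sizes or supports be realized by a reordering of the cycles themselves. *)
Lemma perm_map_lift (A B : eqType) (f : A -> B) (s : seq A) (t : seq B) :
  perm_eq (map f s) t -> exists2 s', perm_eq s s' & map f s' = t.
Proof.
elim: t s => [|b t IH] s p.
  by exists [::] => //; case: s p => // a s /perm_size.
have : b \in map f s by rewrite (perm_mem p) mem_head.
case/mapP=> a as_ bE; have ps := perm_to_rem as_.
have p' : perm_eq (map f (rem a s)) t.
  rewrite -(perm_cons b) {1}bE -map_cons.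
  by apply: perm_trans p; apply: perm_map; rewrite perm_sym.
have [s' q e] := IH _ p'; exists (a :: s') => /=; last by rewrite e -bE.
by apply: perm_trans ps _; rewrite perm_cons.
Qed.

Lemma cycrep_conj (T : finType) (s t : {perm T}) ss tt :
  cycrep s ss -> cycrep t tt -> perm_eq (map size ss) (map size tt) ->
  exists g, t = (s ^ g)%g.
Proof.
move=> rs rt; rewrite perm_sym => /perm_map_lift[tt' ptt esz].
move: rt; rewrite (cycrep_perm t ptt) => rt {tt ptt}.
pose F := flatten ss; pose G := flatten tt'.
have uF : uniq F by exact: cycrep_uniq rs.
have uG : uniq G by exact: cycrep_uniq rt.
have sFG : size F = size G by rewrite !size_flatten /shape esz.
(* [h] matches the concatenated cycle lists position by position; cycles of equal length are
   aligned, so [h] carries successors under [s] to successors under [t]. *)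
pose h x := nth x G (index x F).
have hE x0 x : x \in F -> h x = nth x0 G (index x F).
  by move=> xF; apply: set_nth_default; rewrite -sFG index_mem.
have mapF : map h F = G.
  case: (posnP (size F)) => [/size0nil F0|F0]; first by rewrite F0; move: sFG; rewrite F0 /=; case: (G).
  have [x0 _] : exists x, x \in F by case: (F) F0 => // a l _; exists a; rewrite mem_head.
  apply: (@eq_from_nth _ x0); rewrite size_map // => i iF.
  by rewrite (nth_map x0) // (hE x0) ?mem_nth // index_uniq.
have inF x : x \in F by exact: cycrep_mem rs.
have h_inj : injective h.
  move=> x y; rewrite (hE x x) // (hE x y) // => /eqP.
  by rewrite nth_uniq -?sFG ?index_mem // => /eqP /(congr1 (nth x F)); rewrite !nth_index.
have mapss : map (map h) ss = tt'.
  apply: eq_from_flatten_shape; first by rewrite -map_flatten.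
  by rewrite /shape -map_comp esz; apply: eq_map => l /=; rewrite size_map.
exists (perm h_inj).
have com x : t (h x) = h (s x).
  have /flattenP[l ls xl] := inF x.
  have [_ _ /allP as_] := and3P rs; have [_ _ /allP at_] := and3P rt.
  have ul : uniq l by exact: uniq_flatten_mem ls.
  have /eqP -> := next_cycle (as_ _ ls) xl.
  rewrite -(next_map h_inj ul); apply/eqP; refine (next_cycle (e := frel t) _ (map_f h xl)).
  by apply: at_; rewrite -mapss; apply: map_f.
by apply/permP=> x; rewrite -[x](permKV (perm h_inj)) permJ !permE com.
Qed.

(** * Merging orbits by transpositions *)

Ltac perm_by_count := apply/seq.permP => ?; do 8 rewrite ?count_cat /=; ring.

Section Reach.
Variable T : finType.
Implicit Types (s t : {perm T}) (x y z : T) (A B l : seq T) (ss qs : seq (seq T)).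
Implicit Types (X Y Z q : {set T}) (ps Q : seq {set T}).

Lemma supp_cat A B : supp (A ++ B) = supp A :|: supp B.
Proof. by apply/setP=> x; rewrite !inE mem_cat. Qed.

Lemma supp_perm A B : perm_eq A B -> supp A = supp B.
Proof. by move=> p; apply/setP=> x; rewrite !inE (perm_mem p). Qed.

Lemma card_supp A : uniq A -> #|supp A| = size A.
Proof. by move=> /card_uniqP <-; apply: eq_card => x; rewrite inE. Qed.

Lemma cycrep_head s l ss x : x \in l -> cycrep s (l :: ss) ->
  exists2 A, cycrep s ((x :: A) :: ss) & perm_eq (x :: A) l.
Proof.
case/splitPr=> l1 l2 /cycrep_catC r; exists (l2 ++ l1) => //.
by rewrite -cat_cons perm_catC.
Qed.

(** Supports are enough for the orbits of [t]: any point of an orbit can be rotated to its front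
    before a merge, and in the end only the sizes matter. *)
Definition orbrep s ps := exists2 ss, cycrep s ss & perm_eq ps (map supp ss).

Lemma orbrep_merge t X Y ps x y : x \in X -> y \in Y -> orbrep t (X :: Y :: ps) ->
  orbrep (t * tperm x y)%g ((X :|: Y) :: ps).
Proof.
move=> xX yY [ss r]; rewrite perm_sym => /perm_map_lift[[|l [|m ss']] // p [eX eY eP]].
move: r; rewrite (cycrep_perm _ p) => r.
have xl : x \in l by move: xX; rewrite -eX inE.
have ym : y \in m by move: yY; rewrite -eY inE.
have [A r1 pA] := cycrep_head xl r.
have p2 : perm_eq ((x :: A) :: m :: ss') (m :: (x :: A) :: ss').
  by perm_by_count.
move: r1; rewrite (cycrep_perm _ p2) => /(cycrep_head ym)[B r2 pB].
have p3 : perm_eq ((y :: B) :: (x :: A) :: ss') ((x :: A) :: (y :: B) :: ss').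
  by perm_by_count.
move: r2; rewrite (cycrep_perm _ p3) => /cyc_join r3.
exists ((x :: A ++ y :: B) :: ss') => //=.
by rewrite -cat_cons supp_cat (supp_perm pA) (supp_perm pB) eX eY eP.
Qed.

(* For some t with orbits ps, the cycles of s * t are the lists qs, whose cyclic order
   matters, and other cycles of which only the supports Q are recorded. *)
Definition reach s ps qs Q := exists t Dl,
  [/\ orbrep t ps, cycrep (s * t)%g (qs ++ Dl) & perm_eq Q (map supp Dl)].

Lemma reach_perml s ps ps' qs Q : perm_eq ps ps' -> reach s ps qs Q -> reach s ps' qs Q.
Proof.
move=> p [t [Dl [[ss r p'] rq pq]]]; exists t, Dl; split=> //.
by exists ss => //; apply: perm_trans p'; rewrite perm_sym.
Qed.

Lemma reach_permm s ps qs qs' Q : perm_eq qs qs' -> reach s ps qs Q -> reach s ps qs' Q.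
Proof.
move=> p [t [Dl [r rq pq]]]; exists t, Dl; split=> //.
by rewrite -(cycrep_perm _ (_ : perm_eq (qs ++ Dl) _)) // perm_cat2r.
Qed.

Lemma reach_permr s ps qs Q Q' : perm_eq Q Q' -> reach s ps qs Q -> reach s ps qs Q'.
Proof.
move=> p [t [Dl [r rq pq]]]; exists t, Dl; split=> //.
by apply: perm_trans pq; rewrite perm_sym.
Qed.

Lemma reach_rot s ps A B qs Q :
  reach s ps ((A ++ B) :: qs) Q -> reach s ps ((B ++ A) :: qs) Q.
Proof. by move=> [t [Dl [r rq pq]]]; exists t, Dl; split=> //; apply: cycrep_catC. Qed.

Lemma reach_swap s ps l m qs Q : reach s ps (l :: m :: qs) Q -> reach s ps (m :: l :: qs) Q.
Proof.
apply: reach_permm.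
by perm_by_count.
Qed.

Lemma reach_join s X Y ps x y A B qs Q : x \in X -> y \in Y ->
  reach s (X :: Y :: ps) ((x :: A) :: (y :: B) :: qs) Q ->
  reach s ((X :|: Y) :: ps) ((x :: A ++ y :: B) :: qs) Q.
Proof.
move=> xX yY [t [Dl [r rq pq]]]; exists (t * tperm x y)%g, Dl; split=> //.
  exact: orbrep_merge.
by rewrite mulgA; apply: cyc_join.
Qed.

Lemma reach_split s X Y ps x y A B qs Q : x \in X -> y \in Y ->
  reach s (X :: Y :: ps) ((x :: A ++ y :: B) :: qs) Q ->
  reach s ((X :|: Y) :: ps) ((x :: A) :: (y :: B) :: qs) Q.
Proof.
move=> xX yY [t [Dl [r rq pq]]]; exists (t * tperm x y)%g, Dl; split=> //.
  exact: orbrep_merge.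
by rewrite mulgA; apply: cyc_split.
Qed.

Lemma reach_store s ps l qs Q : reach s ps (l :: qs) Q -> reach s ps qs (supp l :: Q).
Proof.
move=> [t [Dl [r rq pq]]]; exists t, (l :: Dl); split=> //; last by rewrite /= perm_cons.
by rewrite (cycrep_perm _ (_ : perm_eq _ (l :: qs ++ Dl))) // -cat1s perm_catCA.
Qed.

Lemma reach_store_perm s ps l l' qs q Q : supp l' = q -> perm_eq l l' ->
  reach s ps (l :: qs) Q -> reach s ps qs (q :: Q).
Proof. by move=> <- /supp_perm <-; apply: reach_store. Qed.

(** A stored cycle comes back in an unknown cyclic order, so later arguments treat every order of
    the points involved. *)
Lemma reach_fetch s ps qs q Q x : x \in q -> reach s ps qs (q :: Q) ->
  exists2 A, supp (x :: A) = q & reach s ps ((x :: A) :: qs) Q.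
Proof.
move=> xq [t [Dl [r rq]]]; rewrite perm_sym => /perm_map_lift[[|l Dl'] // p [eq eQ]].
move: rq; rewrite (cycrep_perm _ (_ : perm_eq _ (l :: qs ++ Dl'))); last first.
  by apply: (@perm_trans _ (qs ++ l :: Dl')); rewrite ?perm_cat2l // -cat1s perm_catCA.
have xl : x \in l by move: xq; rewrite -eq inE.
case/(cycrep_head xl) => A rA pA; exists A; first by rewrite (supp_perm pA).
by exists t, Dl'; split; rewrite // eQ.
Qed.

Lemma disjoint_supp A B : uniq (A ++ B) -> [disjoint supp A & supp B].
Proof.
rewrite cat_uniq => /and3P[_ d _]; apply/pred0P => x /=; rewrite !inE.
by apply/andP=> [[xA xB]]; case/hasP: d; exists x.
Qed.

Lemma reach_disj s X Y ps qs Q : reach s (X :: Y :: ps) qs Q -> [disjoint X & Y].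
Proof.
move=> [t [Dl [[ss r]]]]; rewrite perm_sym => /perm_map_lift[[|l [|m ss']] // p [eX eY _]] _ _.
move: r; rewrite (cycrep_perm _ p) => /cycrep_uniq /=; rewrite catA cat_uniq => /and3P[u _ _].
by rewrite -eX -eY; apply: disjoint_supp.
Qed.

Lemma reach_uniq s ps qs Q : reach s ps qs Q -> uniq (flatten qs).
Proof. by move=> [t [Dl [_ /cycrep_uniq]]]; rewrite flatten_cat cat_uniq => /and3P[]. Qed.

Lemma sumn_card_supp ss : uniq (flatten ss) ->
  sumn [seq #|X| | X : {set T} <- map supp ss] = size (flatten ss).
Proof.
elim: ss => //= l ss IH; rewrite cat_uniq => /and3P[ul _ us].
by rewrite size_cat IH // card_supp.
Qed.

Lemma orbrep_sum t ps : orbrep t ps -> sumn [seq #|X| | X : {set T} <- ps] = #|T|.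
Proof.
move=> [ss r p]; rewrite (perm_sumn (perm_map _ p)) sumn_card_supp ?(cycrep_uniq r) //.
by have [/perm_size -> _ _] := and3P r; rewrite cardE.
Qed.

Lemma reach_sum s ps qs Q : reach s ps qs Q -> sumn [seq #|X| | X : {set T} <- ps] = #|T|.
Proof. by move=> [t [Dl [r _ _]]]; apply: orbrep_sum r. Qed.

(** Equal numbers of cycles give [s] and [s * t] the same sign, so [t] is even. *)
Lemma reach_parity s ps qs Q : reach s ps qs Q -> size qs + size Q = #|porbits s| ->
  odd (size ps) = odd #|T|.
Proof.
move=> [t [Dl [[ss r p] rq pQ]]] e.
have o1 := cycrep_odd r; have o2 := cycrep_odd rq.
have sp := perm_size p; have sQ := perm_size pQ; rewrite size_map in sp; rewrite size_map in sQ.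
move: o2; rewrite odd_permM o1 /odd_perm size_cat -sQ e -sp.
by case: (odd #|T|); case: (odd _); case: (odd _).
Qed.

Lemma orbrep1 : orbrep 1 [seq [set x : T] | x <- enum T].
Proof.
exists [seq [:: x] | x <- enum T]; last first.
  rewrite -map_comp (eq_map (_ : _ =1 (fun x => [set x]))) // => x /=.
  by apply/setP=> y; rewrite !inE.
apply/and3P; split.
- by rewrite flatten_map1 map_id.
- by apply/mapP=> [[]].
- by apply/allP=> l /mapP[x _ ->] /=; rewrite perm1 eqxx.
Qed.

Lemma reach_start s ss : cycrep s ss -> reach s [seq [set x : T] | x <- enum T] ss [::].
Proof. by move=> r; exists 1%g, [::]; rewrite cats0 mulg1; split=> //; apply: orbrep1. Qed.

(** * Pairs of transpositions inside one cycle *)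

Lemma setI_n0P X q : reflect (exists2 x, x \in X & x \in q) (X :&: q != set0).
Proof.
apply: (iffP (set0Pn _)) => [[x]|[x xX xq]]; last by exists x; rewrite inE xX.
by rewrite inE => /andP[]; exists x.
Qed.

(** The transposition of [x] and [y] cuts off the arc that starts at [x]; that of [x] and [z]
    reattaches it, since [z] lies in the other piece. *)
Lemma reach_join3_list s X Y Z ps x y z A B C qs Q :
  x \in X -> y \in Y -> z \in Z ->
  reach s (X :: Y :: Z :: ps) ((x :: A ++ y :: B ++ z :: C) :: qs) Q ->
  reach s ((X :|: Y :|: Z) :: ps) ((x :: A ++ z :: C ++ y :: B) :: qs) Q.
Proof.
move=> xX yY zZ /(reach_split xX yY) /reach_swap.
rewrite -cat_cons => /reach_rot /reach_swap R.
by apply: reach_join R => //; rewrite inE xX.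
Qed.

(** [p2] and [p4] lie on different sides of the chord from [p1] to [p3]: the first transposition
    separates them, so the second reconnects the cycle. *)
Lemma reach_cross_list s X1 X2 X3 X4 ps p1 p2 p3 p4 A B C D qs Q :
  p1 \in X1 -> p2 \in X2 -> p3 \in X3 -> p4 \in X4 ->
  reach s (X1 :: X2 :: X3 :: X4 :: ps)
    ((p1 :: A ++ p2 :: B ++ p3 :: C ++ p4 :: D) :: qs) Q ->
  reach s ((X1 :|: X3) :: (X2 :|: X4) :: ps)
    ((p2 :: B ++ p1 :: A ++ p4 :: D ++ p3 :: C) :: qs) Q.
Proof.
move=> h1 h2 h3 h4 R.
have {}R : reach s (X1 :: X3 :: X2 :: X4 :: ps)
    ((p1 :: (A ++ p2 :: B) ++ p3 :: C ++ p4 :: D) :: qs) Q.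
  by rewrite -catA; apply: reach_perml R; perm_by_count.
move/(reach_split h1 h3): R; rewrite -cat_cons => /reach_rot /reach_swap.
rewrite -cat_cons => /reach_rot /reach_swap.
have p : perm_eq ((X1 :|: X3) :: X2 :: X4 :: ps) (X2 :: X4 :: (X1 :|: X3) :: ps).
  by perm_by_count.
move/(reach_perml p)/(reach_join h2 h4); rewrite -!catA.
by apply: reach_perml; perm_by_count.
Qed.

Lemma supp_mem (l : seq T) q x : supp l = q -> x \in q -> x \in l.
Proof. by move=> <-; rewrite inE. Qed.

Lemma reach_neq s X Y ps qs Q x y : reach s (X :: Y :: ps) qs Q ->
  x \in X -> y \in Y -> x != y.
Proof. by move/reach_disj=> d xX yY; apply: contraTneq yY => <-; rewrite (disjointFr d). Qed.

Lemma reach_join3 s X Y Z ps qs q Q :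
  X :&: q != set0 -> Y :&: q != set0 -> Z :&: q != set0 ->
  reach s (X :: Y :: Z :: ps) qs (q :: Q) ->
  reach s ((X :|: Y :|: Z) :: ps) qs (q :: Q).
Proof.
case/setI_n0P=> x xX xq /setI_n0P[y yY yq] /setI_n0P[z zZ zq] R.
have pZ : perm_eq (X :: Y :: Z :: ps) (X :: Z :: Y :: ps) by perm_by_count.
have pX : perm_eq (X :: Y :: Z :: ps) (Y :: Z :: X :: ps) by perm_by_count.
have xy := reach_neq R xX yY; have xz := reach_neq (reach_perml pZ R) xX zZ.
have yz := reach_neq (reach_perml pX R) yY zZ.
have [L LE {}R] := reach_fetch xq R.
have yL : y \in L by have := supp_mem LE yq; rewrite inE eq_sym (negbTE xy).
have zL : z \in L by have := supp_mem LE zq; rewrite inE eq_sym (negbTE xz).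
case/splitPr: yL zL LE R => A B; rewrite mem_cat inE eq_sym (negbTE yz) /= => /orP[].
  case/splitPr=> A1 A2 LE; rewrite -catA /= setUAC => R.
  apply: reach_store_perm LE _ (reach_join3_list xX zZ yY (reach_perml pZ R)).
  by perm_by_count.
case/splitPr=> B1 B2 LE R.
apply: reach_store_perm LE _ (reach_join3_list xX yY zZ R).
by perm_by_count.
Qed.

End Reach.

(** * Lists up to reordering *)

Lemma perm_count_head (A : eqType) (p : pred A) (s : seq A) :
  0 < count p s -> exists a s', p a /\ perm_eq s (a :: s').
Proof.
rewrite -has_count => /hasP[a as_ pa]; exists a, (rem a s); split=> //.
exact: perm_to_rem.
Qed.

Lemma filter_cons_cat (A : eqType) (p : pred A) (l : seq A) u v :
  filter p l = u :: v -> exists l1 l2, l = l1 ++ u :: l2 /\ filter p l2 = v.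
Proof.
elim: l => //= x l IH; case: (p x) => [[<- <-]|/IH[l1 [l2 [-> <-]]]].
  by exists [::], l.
by exists (x :: l1), l2.
Qed.

Lemma all2_cat (A B : Type) (r : A -> B -> bool) s1 s2 t1 t2 :
  all2 r s1 t1 -> all2 r s2 t2 -> all2 r (s1 ++ s2) (t1 ++ t2).
Proof. by elim: s1 t1 => [|x s1 IH] [|y t1] //= /andP[-> /IH h] /h. Qed.

Lemma all2_catP (A B : Type) (r : A -> B -> bool) s1 s2 t :
  all2 r (s1 ++ s2) t -> exists t1 t2, [/\ t = t1 ++ t2, all2 r s1 t1 & all2 r s2 t2].
Proof.
elim: s1 t => [|x s1 IH] [|y t] //=; first by exists [::], [::].
  by move=> h; exists [::], (y :: t).
by case/andP=> rxy /IH[t1 [t2 [-> h1 h2]]]; exists (y :: t1), t2; rewrite /= rxy.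
Qed.

Lemma all2_perm (A B : eqType) (r : A -> B -> bool) s s' t :
  perm_eq s s' -> all2 r s t -> exists2 t', perm_eq t t' & all2 r s' t'.
Proof.
elim: s' s t => [|x s' IH] s t p.
  by case: s p => [|? ? /perm_size //] _; case: t => // _; exists [::].
have : x \in s by rewrite (perm_mem p) mem_head.
move=> xs; case/splitPr: xs p => s1 s2 p.
have p' : perm_eq (s1 ++ s2) s'.
  by rewrite -(perm_cons x); apply: perm_trans p; rewrite -cat1s perm_catCA.
case/all2_catP=> t1 [[|y t2] [-> h1 //= /andP[rxy h2]]].
have [t' pt ht] := IH _ _ p' (all2_cat h1 h2).
exists (y :: t') => /=; last by rewrite rxy.
by rewrite -cat1s perm_catCA /= perm_cons.
Qed.

Section Crossing.
Variable T : finType.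
Implicit Types (s t : {perm T}) (x y z : T) (A B l S : seq T) (qs : seq (seq T)).
Implicit Types (X Y Z q : {set T}) (ps Q : seq {set T}) (gs : seq ({set T} * nat)).

Definition sing S : seq {set T} := [seq [set y] | y <- S].

Lemma reach_sing_uniq s S ps qs Q : reach s (sing S ++ ps) qs Q -> uniq S.
Proof.
elim: S ps => //= a S IH ps R; apply/andP; split; last first.
  by apply: (IH ([set a] :: ps)); apply: reach_perml R; perm_by_count.
apply/negP=> aS; case/splitPr: aS R => S1 S2 R.
have p : perm_eq ([set a] :: sing (S1 ++ a :: S2) ++ ps)
   ([set a] :: [set a] :: sing (S1 ++ S2) ++ ps).
  by rewrite /sing !map_cat; perm_by_count.
by have /eqP := reach_neq (reach_perml p R) (set11 a) (set11 a).
Qed.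

Lemma reach_sing_notin s X x S ps qs Q :
  reach s (X :: sing S ++ ps) qs Q -> x \in X -> x \notin S.
Proof.
move=> R xX; apply/negP=> xS; case/splitPr: xS R => S1 S2 R.
have p : perm_eq (X :: sing (S1 ++ x :: S2) ++ ps)
   (X :: [set x] :: sing (S1 ++ S2) ++ ps).
  by rewrite /sing !map_cat; perm_by_count.
by have /eqP := reach_neq (reach_perml p R) xX (set11 x).
Qed.

Lemma reach_perm_sing s S S' ps ps' qs Q : perm_eq S S' ->
  reach s (ps ++ sing S ++ ps') qs Q -> reach s (ps ++ sing S' ++ ps') qs Q.
Proof. by move=> p; apply: reach_perml; rewrite perm_cat2l perm_cat2r; apply: perm_map. Qed.

Lemma filter_mem_perm S l : uniq S -> uniq l -> {subset S <= l} ->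
  perm_eq (filter (mem S) l) S.
Proof.
move=> uS ul sub; apply: uniq_perm; rewrite ?filter_uniq // => z.
by rewrite mem_filter inE /=; case zS: (z \in S) => //=; apply: sub.
Qed.

(* Two transpositions keep a cycle connected exactly when they cross, so the cyclic
   order decides which of a, b, c joins X. *)
Lemma reach_pair_up s X a b c ps qs q Q :
  X :&: q != set0 -> all (mem q) [:: a; b; c] ->
  reach s (X :: sing [:: a; b; c] ++ ps) qs (q :: Q) ->
  exists u v w, perm_eq [:: u; v; w] [:: a; b; c] /\
    reach s ((X :|: [set u]) :: [set v; w] :: ps) qs (q :: Q).
Proof.
case/setI_n0P=> x xX xq /allP Sq R; have xS := reach_sing_notin R xX.
have uS : uniq [:: a; b; c].
  by apply: (@reach_sing_uniq s _ (X :: ps) qs (q :: Q)); apply: reach_perml R; perm_by_count.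
have [L LE {}R] := reach_fetch xq R.
have uL : uniq L by have := reach_uniq R; rewrite /= cat_uniq => /andP[_ /andP[]].
have SL : {subset [:: a; b; c] <= L}.
  move=> y yS; have := supp_mem LE (Sq y yS); rewrite inE => /predU1P[yx|//].
  by rewrite -yx yS in xS.
have pf := filter_mem_perm uS uL SL.
case E1: (filter _ L) pf => [|u1 [|u2 [|u3 [|]]]] pf; have //= := perm_size pf => _.
have [A [L1 [LA /filter_cons_cat[B [L2 [LB /filter_cons_cat[C [D [LC _]]]]]]]]] := filter_cons_cat E1.
subst L L1 L2; exists u2, u1, u3; split; first by apply: perm_trans pf; perm_by_count.
have pp := reach_perm_sing (ps := [:: X]) (_ : perm_eq [:: a; b; c] [:: u1; u2; u3]) R.
have {}R : reach s (X :: [set u1] :: [set u2] :: [set u3] :: ps)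
   ((x :: A ++ u1 :: B ++ u2 :: C ++ u3 :: D) :: qs) Q by apply: pp; rewrite perm_sym.
apply: reach_store_perm LE _ (reach_cross_list xX (set11 u1) (set11 u2) (set11 u3) R).
by perm_by_count.
Qed.

(** [x] and [x'] divide the cycle into two arcs, and two of the three points share an arc. As seen
    from [x], the farther of these is joined to [x] and the nearer to [x'], which gives crossing
    chords. With only two points, one in each arc, this would fail. *)
Lemma reach_extend_two s X X' a b c ps qs q Q :
  X :&: q != set0 -> X' :&: q != set0 -> all (mem q) [:: a; b; c] ->
  reach s (X :: X' :: sing [:: a; b; c] ++ ps) qs (q :: Q) ->
  exists u v w, perm_eq [:: u; v; w] [:: a; b; c] /\
    reach s ((X :|: [set u]) :: (X' :|: [set v]) :: [set w] :: ps) qs (q :: Q).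
Proof.
case/setI_n0P=> x xX xq /setI_n0P[x' xX' xq'] /allP Sq R.
have xx' := reach_neq R xX xX'.
have xS : x \notin [:: a; b; c].
  by apply: (@reach_sing_notin s X x _ (X' :: ps) qs (q :: Q)) xX; apply: reach_perml R; perm_by_count.
have xS' : x' \notin [:: a; b; c].
  by apply: (@reach_sing_notin s X' x' _ (X :: ps) qs (q :: Q)) xX'; apply: reach_perml R; perm_by_count.
have uS : uniq [:: x'; a; b; c].
  rewrite /= -/(uniq [:: a; b; c]) xS'.
  by apply: (@reach_sing_uniq s _ (X :: X' :: ps) qs (q :: Q)); apply: reach_perml R; perm_by_count.
have [L LE {}R] := reach_fetch xq R.
have uL : uniq L by have := reach_uniq R; rewrite /= cat_uniq => /andP[_ /andP[]].
have SL : {subset [:: x'; a; b; c] <= L}.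
  move=> y; rewrite inE => yS.
  have yq : y \in q by case/predU1P: yS => [->//|/Sq].
  have := supp_mem LE yq; rewrite inE => /predU1P[yx|//].
  by move: yS; rewrite yx (negbTE xS) orbF (negbTE xx').
have pf := filter_mem_perm uS uL SL.
case E1: (filter _ L) pf => [|u1 [|u2 [|u3 [|u4 [|]]]]] pf; have //= := perm_size pf => _.
have [A [L1 [LA /filter_cons_cat[B [L2 [LB /filter_cons_cat[C [L3 [LC /filter_cons_cat[D [E [LD _]]]]]]]]]]]] := filter_cons_cat E1.
have pp v1 v2 v3 : perm_eq [:: v1; v2; v3] [:: a; b; c] ->
  reach s (X :: X' :: [set v1] :: [set v2] :: [set v3] :: ps) ((x :: L) :: qs) Q.
  by rewrite perm_sym => p; apply: (reach_perm_sing (ps := [:: X; X']) p R).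
have : x' \in [:: u1; u2; u3; u4] by rewrite (perm_mem pf) mem_head.
subst L L1 L2 L3 => {E1}; rewrite !inE => /or4P[] /eqP x'E; subst x'.
- have p3 : perm_eq [:: u2; u3; u4] [:: a; b; c] by rewrite -(perm_cons u1).
  exists u2, u3, u4; split=> //.
  have {}R : reach s (X :: X' :: [set u2] :: [set u3] :: [set u4] :: ps)
    ((x :: A ++ u1 :: B ++ u2 :: C ++ u3 :: (D ++ u4 :: E)) :: qs) Q by apply: pp.
  apply: reach_store_perm LE _ (reach_cross_list xX xX' (set11 u2) (set11 u3) R).
  by perm_by_count.
- have p3 : perm_eq [:: u3; u4; u1] [:: a; b; c].
    by rewrite -(perm_cons u2); apply: perm_trans pf; perm_by_count.
  exists u3, u4, u1; split=> //.
  have {}R : reach s (X :: X' :: [set u3] :: [set u4] :: [set u1] :: ps)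
    ((x :: (A ++ u1 :: B) ++ u2 :: C ++ u3 :: D ++ u4 :: E) :: qs) Q by rewrite -catA; apply: pp.
  apply: reach_store_perm LE _ (reach_cross_list xX xX' (set11 u3) (set11 u4) R).
  by perm_by_count.
- have p3 : perm_eq [:: u2; u1; u4] [:: a; b; c].
    by rewrite -(perm_cons u3); apply: perm_trans pf; perm_by_count.
  exists u2, u1, u4; split=> //.
  have {}R : reach s (X :: [set u1] :: [set u2] :: X' :: [set u4] :: ps)
    ((x :: A ++ u1 :: B ++ u2 :: C ++ u3 :: (D ++ u4 :: E)) :: qs) Q.
    by apply: reach_perml (pp _ _ _ p3); perm_by_count.
  rewrite (setUC X'); apply: reach_store_perm LE _ (reach_cross_list xX (set11 u1) (set11 u2) xX' R).
  by perm_by_count.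
- have p3 : perm_eq [:: u2; u1; u3] [:: a; b; c].
    by rewrite -(perm_cons u4); apply: perm_trans pf; perm_by_count.
  exists u2, u1, u3; split=> //.
  have {}R : reach s (X :: [set u1] :: [set u2] :: X' :: [set u3] :: ps)
    ((x :: A ++ u1 :: B ++ u2 :: (C ++ u3 :: D) ++ u4 :: E) :: qs) Q.
    by rewrite -catA; apply: reach_perml (pp _ _ _ p3); perm_by_count.
  rewrite (setUC X'); apply: reach_store_perm LE _ (reach_cross_list xX (set11 u1) (set11 u2) xX' R).
  by perm_by_count.
Qed.

End Crossing.

(** * Filling one cycle *)

Ltac lia1 H := move: H; clear; rewrite /=; lia.

Section Fill.
Variable T : finType.
Implicit Types (s t : {perm T}) (x y z : T) (A B l S : seq T) (qs : seq (seq T)).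
Implicit Types (X Y Z q : {set T}) (ps Q : seq {set T}) (gs : seq ({set T} * nat)).

(* A group (X, e) asks the orbit X to absorb e fixed points of t lying in q;
   X = set0 asks for a new orbit made of e such points. *)
Definition fresh (g : {set T} * nat) := g.1 == set0.
Definition oddold (g : {set T} * nat) := (g.1 != set0) && odd g.2.
Definition blocks gs := [seq g.1 | g <- gs & g.1 != set0].

Definition groupable q (g : {set T} * nat) :=
  (g.1 :&: q != set0) || (g.1 == set0) && (0 < g.2).

Definition absorbed q (g : {set T} * nat) (W : {set T}) :=
  [&& g.1 \subset W, #|W| == #|g.1| + g.2 & W :&: q != set0].

Lemma blocks_perm gs gs' : perm_eq gs gs' -> perm_eq (blocks gs) (blocks gs').
Proof. by move=> p; apply/perm_map/perm_filter. Qed.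

Lemma setIU1_n0 X q u : u \in q -> (X :|: [set u]) :&: q != set0.
Proof. by move=> uq; apply/setI_n0P; exists u; rewrite // !inE eqxx orbT. Qed.

Lemma setU1_n0 X u : X :|: [set u] != set0.
Proof. by apply/set0Pn; exists u; rewrite !inE eqxx orbT. Qed.

Lemma absorbedU1 q X e u W : u \notin X -> absorbed q (X :|: [set u], e) W -> absorbed q (X, e.+1) W.
Proof.
move=> uX /and3P[/= sub /eqP c n]; apply/and3P; split=> //=.
  by apply: subset_trans sub; apply: subsetUl.
by rewrite c setUC cardsU1 uX; apply/eqP; lia.
Qed.

Lemma parity_groups gs :
  odd (sumn (map snd gs)) =
  odd (count oddold gs) (+) odd (count (fun g => fresh g && odd g.2) gs).
Proof.
elim: gs => //= g gs IH; rewrite !oddD IH /oddold /fresh.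
by case: (g.1 == set0); case: (odd g.2) => /=; case: (odd _); case: (odd _).
Qed.

Lemma count_fresh_split gs : count fresh gs =
  count (fun g => fresh g && odd g.2) gs + count (fun g => fresh g && ~~ odd g.2) gs.
Proof. by elim: gs => //= g gs ->; case: (fresh g); case: (odd _) => /=; lia. Qed.

(* Serving two old orbits with odd demands at once needs a spare third point, by
   [reach_extend_two]; hence the lower bound on size S. *)
Definition fillable s q gs S ps qs Q :=
  [/\ reach s (blocks gs ++ sing S ++ ps) qs (q :: Q), all (groupable q) gs, all (mem q) S,
      sumn (map snd gs) = size S & odd (size S) = odd (count fresh gs)]
  /\ (count oddold gs <= 1 \/ 2 * count oddold gs + 3 <= size S).

Lemma fillable_perm s q gs gs' S ps qs Q : perm_eq gs gs' ->
  fillable s q gs S ps qs Q -> fillable s q gs' S ps qs Q.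
Proof.
move=> p [[R a b c d] e]; rewrite /fillable -!(seq.permP p) -(perm_all _ p).
rewrite -(perm_sumn (perm_map _ p)); split=> //; split=> //.
by apply: reach_perml R; rewrite perm_cat2r blocks_perm.
Qed.

(** Induction on the number of spare points: odd demands of old orbits are cleared first, then new
    orbits are started one at a time, and the even demands left over are met two points at a
    time. *)
Lemma fill s q gs S ps qs Q : fillable s q gs S ps qs Q ->
  exists2 Ws, reach s (Ws ++ ps) qs (q :: Q) & all2 (absorbed q) gs Ws.
Proof.
have [m] := ubnP (size S); elim: m gs S => // m IH gs S.
rewrite ltnS => Sm H.
have perm_concl gs' : perm_eq gs gs' ->
   (exists2 Ws, reach s (Ws ++ ps) qs (q :: Q) & all2 (absorbed q) gs' Ws) ->
   (exists2 Ws, reach s (Ws ++ ps) qs (q :: Q) & all2 (absorbed q) gs Ws).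
  rewrite perm_sym => p [Ws R /(all2_perm p)[Ws' pW h]]; exists Ws' => //.
  by apply: reach_perml R; rewrite perm_cat2r.
(* Two odd demands drop by one together; the third point returns to the pool. *)
have [d2|d1] := leqP 2 (count oddold gs).
  have [g1 [gs1 [o1 p1]]] := perm_count_head (ltnW d2).
  have : 0 < count oddold gs1 by move: d2; rewrite (seq.permP p1) /= o1 add1n.
  case/perm_count_head=> g2 [gs2 [o2 p2]].
  have p : perm_eq gs (g1 :: g2 :: gs2) by apply: perm_trans p1 _; rewrite perm_cons.
  apply: (perm_concl _ p); move: H => /(fillable_perm p) {p p1 p2 gs1 d2 perm_concl gs}.
  case: g1 g2 o1 o2 => [X [|e]] [X' [|e']] //; rewrite /oddold /= ?andbF // => /andP[nX oe] /andP[nX' oe'].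
  rewrite /fillable /= /oddold /fresh /blocks /= nX nX' oe oe' (negbTE nX) (negbTE nX') /=.
  case=> -[R /and3P[g1 g2 ag] aS sz od] [c3|c3]; first by lia1 c3.
  rewrite /groupable /= (negbTE nX) (negbTE nX') !orbF in g1 g2.
  have S3 : 2 < size S by lia1 c3.
  case: S S3 Sm aS sz R od c3 => [|a [|b [|c S]]] // _ Sm aS sz R od c3; have {aS} [a3 aS] : all (mem q) [:: a; b; c] /\ all (mem q) S.
    by move: aS => /= /and4P[-> -> -> ->].
  set bs := [seq g.1 | g <- gs2 & g.1 != set0] in R.
  have {}R : reach s (X :: X' :: sing [:: a; b; c] ++ (bs ++ sing S ++ ps)) qs (q :: Q).
    by apply: reach_perml R; perm_by_count.
  have [u [v [w [pu R']]]] := reach_extend_two g1 g2 a3 R.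
  have := a3; rewrite -(perm_all _ pu) /= andbT => /and3P[uq vq wq].
  have uX : u \notin X.
    have R2 : reach s (X :: sing [:: a; b; c] ++ (X' :: bs ++ sing S ++ ps)) qs (q :: Q).
      by apply: reach_perml R; perm_by_count.
    by apply/negP => /(reach_sing_notin R2); rewrite -(perm_mem pu) mem_head.
  have vX : v \notin X'.
    have R2 : reach s (X' :: sing [:: a; b; c] ++ (X :: bs ++ sing S ++ ps)) qs (q :: Q).
      by apply: reach_perml R; perm_by_count.
    by apply/negP => /(reach_sing_notin R2); rewrite -(perm_mem pu) !inE eqxx orbT.
  have [||Ws RW /=] := IH [:: (X :|: [set u], e), (X' :|: [set v], e') & gs2] (w :: S) _ _.
  - by lia1 Sm.
  - rewrite /fillable /= /oddold /fresh /blocks /= !setU1_n0 /= (negbTE (setU1_n0 _ _)) (negbTE (setU1_n0 _ _)) (negbTE oe) (negbTE oe') /groupable /= !setIU1_n0 //=.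
    split; first split=> //.
    + by apply: reach_perml R'; rewrite -/bs; perm_by_count.
    + by rewrite wq.
    + by lia1 sz.
    + by lia1 od.
    + by lia1 c3.
  case: Ws RW => [|W [|W' Ws]] RW //; first by rewrite andbF.
  case/and3P=> h1 h2 h3; exists (W :: W' :: Ws) => //=.
  by rewrite (absorbedU1 uX h1) (absorbedU1 vX h2).
have [d0|d0] := posnP (count oddold gs); last first.
  have d1' : count oddold gs = 1 by move: d0 d1; clear; lia.
  have [g1 [gs1 [o1 p1]]] := perm_count_head d0.
  (* Modulo 2, [size S] is the number of groups with odd demand and also the number of new groups. A
     single odd old demand thus forces a new group with even demand, hence at least 2, which can
     take the other two points. *)
  have nof : 0 < count (fun g => fresh g && ~~ odd g.2) gs1.
    have c1 : count (fun g => fresh g && ~~ odd g.2) gs = count (fun g => fresh g && ~~ odd g.2) gs1.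
      rewrite (seq.permP p1) /= /fresh; move: o1; rewrite /oddold => /andP[/negbTE -> _].
      by rewrite add0n.
    case: H => -[_ _ _ sz od] _; rewrite -c1 lt0n; apply/eqP => c0.
    by move: od; rewrite -sz parity_groups d1' count_fresh_split c0 addn0 /=; case: (odd (count _ _)).
  case/perm_count_head: nof => g2 [gs2 [o2 p2]].
  have p : perm_eq gs (g1 :: g2 :: gs2) by apply: perm_trans p1 _; rewrite perm_cons.
  have c2 : count oddold gs2 = 0.
    by move: d1'; rewrite (seq.permP p) /= o1 add1n => -[/eqP]; rewrite addn_eq0 => /andP[_ /eqP].
  apply: (perm_concl _ p); move: H => /(fillable_perm p) {p p1 p2 gs1 d1 d0 d1' perm_concl gs}.
  case: g1 g2 o1 o2 => [X [|e]] [X' e']; rewrite /oddold /fresh /= ?andbF // => /andP[nX oe] /andP[/eqP -> oe'].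
  rewrite /fillable /= /oddold /fresh /blocks /= nX (negbTE nX) eqxx /= oe.
  case=> -[R /and3P[g1 g2 ag] aS sz od] _.
  rewrite /groupable /= (negbTE nX) eqxx set0I eqxx !orbF /= in g1 g2.
  case: e' g2 oe' sz => [|[|e']] // _ oe' sz.
  have S3 : 2 < size S by lia1 sz.
  case: S S3 Sm aS sz R od => [|a [|b [|c S]]] // _ Sm aS sz R od; have {aS} [a3 aS] : all (mem q) [:: a; b; c] /\ all (mem q) S.
    by move: aS => /= /and4P[-> -> -> ->].
  set bs := [seq g.1 | g <- gs2 & g.1 != set0] in R.
  have {}R : reach s (X :: sing [:: a; b; c] ++ (bs ++ sing S ++ ps)) qs (q :: Q).
    by apply: reach_perml R; perm_by_count.
  have [u [v [w [pu R']]]] := reach_pair_up g1 a3 R.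
  have := a3; rewrite -(perm_all _ pu) /= andbT => /and3P[uq vq wq].
  have uX : u \notin X.
    by apply/negP => /(reach_sing_notin R); rewrite -(perm_mem pu) mem_head.
  have vw : v != w.
    have : uniq [:: a; b; c].
      by apply: (@reach_sing_uniq T s _ (X :: bs ++ sing S ++ ps) qs (q :: Q)); apply: reach_perml R; perm_by_count.
    by rewrite -(perm_uniq pu) /= !inE => /and3P[_ -> _].
  have n2 : [set v; w] != set0 by apply/set0Pn; exists v; rewrite !inE eqxx.
  have [||Ws RW /=] := IH [:: (X :|: [set u], e), ([set v; w], e') & gs2] S _ _.
  - by lia1 Sm.
  - rewrite /fillable /= /oddold /fresh /blocks /= !setU1_n0 /= (negbTE (setU1_n0 _ _)) ?n2 ?(negbTE n2) ?(negbTE (setU1_n0 _ _)) (negbTE oe) /groupable /= !setIU1_n0 //=.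
    have ne' : odd e' = false by lia1 oe'.
    rewrite ne'; split; first split=> //.
    + by lia1 sz.
    + by lia1 od.
    by left; move: c2; rewrite /oddold => ->.
  case: Ws RW => [|W [|W' Ws]] RW //; first by rewrite andbF.
  case/and3P=> h1 h2 h3; exists (W :: W' :: Ws) => //=.
  rewrite (absorbedU1 uX h1) h3 andbT /=.
  case/and3P: h2 => /= _ /eqP c2' n; rewrite /absorbed /= sub0set cards0 n andbT.
  by apply/eqP; rewrite c2' cards2 vw.
(* Starting a new orbit takes one fixed point and no transposition. It may leave one odd old demand,
   which [fillable] allows. *)
have [f0|] := posnP (count fresh gs); last first.
  case/perm_count_head=> g1 [gs1 [o1 p]].
  have c2 : count oddold gs1 = 0 by move: d0; rewrite (seq.permP p) /= => /eqP; rewrite addn_eq0 => /andP[_ /eqP].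
  apply: (perm_concl _ p); move: H => /(fillable_perm p) {p d1 d0 perm_concl gs}.
  case: g1 o1 => [X e]; rewrite /fresh /= => /eqP ->.
  rewrite /fillable /= /oddold /fresh /blocks /= !eqxx /= /groupable /= set0I eqxx /=.
  case=> -[R /andP[e0 ag] aS sz od] _.
  case: e e0 sz => // e _ sz.
  have S3 : 0 < size S by lia1 sz.
  case: S S3 Sm aS sz R od => [|a S] // _ Sm /= /andP[aq aS] sz R od.
  have na : [set a] != set0 by apply/set0Pn; exists a; rewrite inE.
  have naq : [set a] :&: q != set0 by apply/setI_n0P; exists a; rewrite ?inE.
  have [||Ws RW /=] := IH (([set a], e) :: gs1) S _ _.
  - by lia1 Sm.
  - rewrite /fillable /= /oddold /fresh /blocks /= na (negbTE na) /groupable /= naq.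
    split; first split=> //.
    + by apply: reach_perml R; perm_by_count.
    + by lia1 sz.
    + by lia1 od.
    left; move: c2; rewrite /oddold => ->; by case: (odd e).
  case: Ws RW => [|W Ws] RW //.
  case/andP=> h1 h2; exists (W :: Ws) => //=; rewrite h2 andbT.
  case/and3P: h1 => /= _ /eqP c2' n; rewrite /absorbed /= sub0set cards0 n andbT.
  by apply/eqP; rewrite c2' cards1.
(* Only even demands of old orbits remain, so points are absorbed in pairs by [reach_join3]. *)
have [e0|] := posnP (count (fun g : {set T} * nat => 0 < g.2) gs); last first.
  case/perm_count_head=> g1 [gs1 [o1 p]].
  have c2 : count oddold gs1 = 0 by move: d0; rewrite (seq.permP p) /= => /eqP; rewrite addn_eq0 => /andP[_ /eqP].
  have o2 : ~~ oddold g1 by move: d0; rewrite (seq.permP p) /=; case: (oddold g1).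
  have o3 : ~~ fresh g1 by move: f0; rewrite (seq.permP p) /=; case: (fresh g1).
  apply: (perm_concl _ p); move: H => /(fillable_perm p) {p d1 d0 f0 perm_concl gs}.
  case: g1 o1 o2 o3 => [X e]; rewrite /oddold /fresh /= => e0 oe nX.
  rewrite nX /= in oe.
  rewrite /fillable /= /oddold /fresh /blocks /= nX (negbTE nX) (negbTE oe) /= /groupable /= (negbTE nX) orbF.
  case=> -[R /andP[g1 ag] aS sz od] _.
  case: e e0 sz oe => [|[|e]] // _ sz oe.
  have S3 : 1 < size S by lia1 sz.
  case: S S3 Sm aS sz R od => [|a [|b S]] // _ Sm /= /and3P[aq bq aS] sz R od.
  set bs := [seq g.1 | g <- gs1 & g.1 != set0] in R.
  have {}R : reach s (X :: sing [:: a; b] ++ (bs ++ sing S ++ ps)) qs (q :: Q).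
    by apply: reach_perml R; perm_by_count.
  have naq x : x \in q -> [set x] :&: q != set0 by move=> xq; apply/setI_n0P; exists x; rewrite ?inE.
  have R' := reach_join3 g1 (naq _ aq) (naq _ bq) R.
  have aX : a \notin X by apply/negP => /(reach_sing_notin R); rewrite mem_head.
  have bX : b \notin X :|: [set a].
    rewrite !inE negb_or; apply/andP; split.
      by apply/negP => /(reach_sing_notin R); rewrite !inE eqxx orbT.
    have : uniq [:: a; b].
      by apply: (@reach_sing_uniq T s _ (X :: bs ++ sing S ++ ps) qs (q :: Q)); apply: reach_perml R; perm_by_count.
    by rewrite /= inE andbT eq_sym.
  have [||Ws RW /=] := IH ((X :|: [set a] :|: [set b], e) :: gs1) S _ _.
  - by lia1 Sm.
  - rewrite /fillable /= /oddold /fresh /blocks /= !setU1_n0 (negbTE (setU1_n0 _ _)) /groupable /= !setIU1_n0 //=.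
    split; first split=> //.
    + by lia1 sz.
    + by lia1 od.
    by left; move: c2; rewrite /oddold => ->; case: (odd e).
  case: Ws RW => [|W Ws] RW //.
  case/andP=> h1 h2; exists (W :: Ws) => //=; rewrite h2 andbT.
  by apply: (absorbedU1 aX); apply: (absorbedU1 bX).
case: H => -[R gp _ sz od] _.
have z0 : sumn (map snd gs) = 0.
  by elim: (gs) e0 => //= g gs' IH' h; rewrite IH'; lia.
have bE : blocks gs = map fst gs.
  rewrite /blocks; move: f0; rewrite /fresh; elim: (gs) => //= g gs' IH'.
  by case: eqP => //= _ h; rewrite IH'.
case: S sz R {Sm od} => [|? ?]; rewrite z0 // => _; rewrite bE => R.
exists (map fst gs) => //.
elim: gs gp e0 f0 {IH perm_concl d1 d0 z0 bE R} => //= g gs IH /andP[gp a] e0 f0.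
rewrite IH //; try lia; rewrite andbT.
have g20 : g.2 = 0 by move: e0; case: (g.2).
have g10 : ~~ fresh g by move: f0; case: (fresh g).
move: gp; rewrite /groupable -/(fresh g) (negbTE g10) orbF /absorbed subxx g20 addn0 eqxx => -> //.
Qed.

End Fill.

(** * Orbits straddling two cycles *)

Ltac list_eq := by rewrite /= -?catA /= -?catA /= -?catA.

Ltac sing_perm := rewrite /sing; do 4 rewrite /= ?map_cat; perm_by_count.

Section Seeds.
Variable T : finType.
Implicit Types (s t : {perm T}) (x y z : T) (A B K R P l S : seq T) (qs : seq (seq T)).
Implicit Types (X Y q : {set T}) (ps Q : seq {set T}).

Lemma reach_turn A B s ps l l' qs Q : l = A ++ B -> l' = B ++ A ->
  reach s ps (l :: qs) Q -> reach s ps (l' :: qs) Q.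
Proof. by move=> -> ->; apply: reach_rot. Qed.

(** The net effect on the two cycles is an exchange of [a1] and [b1]: lengths are unchanged, and
    each new orbit has one point in either cycle. *)
Lemma seed_swap s a1 a2 b1 b2 K R KA RA ps qs Q :
  reach s (sing [:: a1; b1; a2; b2] ++ ps)
    ((K ++ b1 :: b2 :: R) :: (KA ++ a1 :: a2 :: RA) :: qs) Q ->
  reach s ([set a1; b1] :: [set a2; b2] :: ps)
    ((K ++ a1 :: b2 :: R) :: (KA ++ b1 :: a2 :: RA) :: qs) Q.
Proof.
move/reach_rot/reach_swap/reach_rot => R0.
have R1 := reach_join (set11 a1) (set11 b1) R0.
have p : perm_eq ([set a1; b1] :: [set a2] :: [set b2] :: ps)
   ([set a2] :: [set b2] :: [set a1; b1] :: ps) by perm_by_count.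
have R2 : reach s ([set a2] :: [set b2] :: [set a1; b1] :: ps)
    ((a2 :: (RA ++ KA ++ [:: b1]) ++ b2 :: R ++ K ++ [:: a1]) :: qs) Q.
  by apply: reach_perml p (reach_turn (A := [:: a1]) _ _ R1) ; list_eq.
have R3 := reach_split (set11 a2) (set11 b2) R2.
have R4 : reach s ([set a2; b2] :: [set a1; b1] :: ps)
   ((KA ++ b1 :: a2 :: RA) :: (b2 :: R ++ K ++ [:: a1]) :: qs) Q.
  by apply: (reach_turn (A := a2 :: RA) (B := KA ++ [:: b1]) _ _ R3); list_eq.
have R5 : reach s ([set a2; b2] :: [set a1; b1] :: ps)
   ((K ++ a1 :: b2 :: R) :: (KA ++ b1 :: a2 :: RA) :: qs) Q.
  by apply: (reach_turn (A := b2 :: R) (B := K ++ [:: a1]) _ _ (reach_swap R4)); list_eq.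
by apply: reach_perml R5; perm_by_count.
Qed.

(* The cycle x :: A is absorbed, and an arc of the same length is cut out instead. *)
Lemma seed_cut s x y z w K R A Z ps qs Q :
  reach s (sing [:: y; x; z; w] ++ ps)
    ((K ++ y :: z :: Z ++ w :: R) :: (x :: A) :: qs) Q ->
  reach s ([set z; w] :: [set y; x] :: ps)
    ((K ++ x :: A ++ y :: w :: R) :: (z :: Z) :: qs) Q.
Proof.
move/reach_rot => R0; have R1 := reach_join (set11 y) (set11 x) R0.
have p : perm_eq ([set y; x] :: [set z] :: [set w] :: ps)
   ([set z] :: [set w] :: [set y; x] :: ps) by perm_by_count.
have R2 : reach s ([set z] :: [set w] :: [set y; x] :: ps)
    ((z :: Z ++ w :: R ++ K ++ x :: A ++ [:: y]) :: qs) Q.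
  by apply: reach_perml p (reach_turn (A := [:: y]) _ _ R1) ; list_eq.
have R3 := reach_swap (reach_split (set11 z) (set11 w) R2).
by apply: (reach_turn (A := w :: R) (B := K ++ x :: A ++ [:: y]) _ _ R3); list_eq.
Qed.

(* Unlike [seed_cut] this also works for two cycles of equal length: exchanging arcs of
   lengths that differ by 2 first makes room for cutting out an arc. *)
Lemma seed_exchange s x1 w y z x2 y2 u1 u2 y1 x K R P ps qs Q :
  reach s (sing [:: x1; y1; x2; y2; y; x; z; w] ++ ps)
    ((K ++ y2 :: u1 :: u2 :: y1 :: x :: R) :: (x1 :: w :: y :: z :: P ++ [:: x2]) :: qs) Q ->
  reach s ([set z; w] :: [set x2; y2] :: [set x1; y1] :: [set y; x] :: ps)
    (((K ++ [:: x2; y1; y; w; x]) ++ R) :: ([:: y2; u1; u2; x1; z] ++ P) :: qs) Q.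
Proof.
move=> R0.
have {R0} R0 : reach s (sing [:: x1; y1; x2; y2; y; x; z; w] ++ ps)
    ((y1 :: x :: R ++ K ++ [:: y2; u1; u2]) :: (x1 :: w :: y :: z :: P ++ [:: x2]) :: qs) Q.
  by apply: (reach_turn (A := K ++ [:: y2; u1; u2]) (B := y1 :: x :: R) _ _ R0); list_eq.
have R1 := reach_join (set11 x1) (set11 y1) (reach_swap R0).
have p1 : perm_eq ([set x1; y1] :: sing [:: x2; y2; y; x; z; w] ++ ps)
   ([set x2] :: [set y2] :: [set x1; y1] :: sing [:: y; x; z; w] ++ ps) by perm_by_count.
have {}R1 : reach s ([set x2] :: [set y2] :: [set x1; y1] :: sing [:: y; x; z; w] ++ ps)
  ((x2 :: (y1 :: x :: R ++ K) ++ y2 :: u1 :: u2 :: x1 :: w :: y :: z :: P) :: qs) Q.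
  apply: reach_perml p1 (reach_turn (A := x1 :: w :: y :: z :: P)
    (B := x2 :: y1 :: x :: R ++ K ++ [:: y2; u1; u2]) _ _ R1); list_eq.
have R2 := reach_split (set11 x2) (set11 y2) R1.
have p2 : perm_eq ([set x2; y2] :: [set x1; y1] :: sing [:: y; x; z; w] ++ ps)
   ([set y] :: [set x] :: [set x2; y2] :: [set x1; y1] :: sing [:: z; w] ++ ps) by perm_by_count.
have {}R2 : reach s ([set y] :: [set x] :: [set x2; y2] :: [set x1; y1] :: sing [:: z; w] ++ ps)
  ((x :: R ++ K ++ [:: x2; y1]) :: (y2 :: u1 :: u2 :: x1 :: w :: y :: z :: P) :: qs) Q.
  by apply: reach_perml p2 (reach_turn (A := [:: x2; y1]) (B := x :: R ++ K) _ _ R2); list_eq.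
have {}R2 : reach s ([set y] :: [set x] :: [set x2; y2] :: [set x1; y1] :: sing [:: z; w] ++ ps)
  ((y :: z :: P ++ [:: y2; u1; u2; x1; w]) :: (x :: R ++ K ++ [:: x2; y1]) :: qs) Q.
  by apply: (reach_turn (A := [:: y2; u1; u2; x1; w]) (B := y :: z :: P) _ _ (reach_swap R2)); list_eq.
have R3 := reach_join (set11 y) (set11 x) R2.
have p3 : perm_eq ([set y; x] :: [set x2; y2] :: [set x1; y1] :: sing [:: z; w] ++ ps)
   ([set z] :: [set w] :: [set x2; y2] :: [set x1; y1] :: [set y; x] :: ps) by perm_by_count.
have {}R3 : reach s ([set z] :: [set w] :: [set x2; y2] :: [set x1; y1] :: [set y; x] :: ps)
  ((z :: (P ++ [:: y2; u1; u2; x1]) ++ w :: x :: R ++ K ++ [:: x2; y1; y]) :: qs) Q.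
  by apply: reach_perml p3 (reach_turn (A := [:: y]) (B := z :: (P ++ [:: y2; u1; u2; x1; w])
    ++ x :: R ++ K ++ [:: x2; y1]) _ _ R3); list_eq.
have R4 := reach_split (set11 z) (set11 w) R3.
have {}R4 : reach s ([set z; w] :: [set x2; y2] :: [set x1; y1] :: [set y; x] :: ps)
  (([:: y2; u1; u2; x1; z] ++ P) :: (w :: x :: R ++ K ++ [:: x2; y1; y]) :: qs) Q.
  by apply: (reach_turn (A := z :: P) (B := [:: y2; u1; u2; x1]) _ _ R4).
apply: (reach_turn (A := w :: x :: R) (B := K ++ [:: x2; y1; y]) _ _ (reach_swap R4)).
  by rewrite -?catA.
by rewrite /= -?catA.
Qed.

Definition crossing (U V X : {set T}) := [&& #|X| == 2, X :&: U != set0 & X :&: V != set0].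

Lemma crossingS (U U' V V' X : {set T}) : U \subset U' -> V \subset V' ->
  crossing U V X -> crossing U' V' X.
Proof.
rewrite /crossing => sU sV /and3P[-> /setI_n0P[u uX uU] /setI_n0P[v vX vV]]; apply/and3P; split=> //.
  by apply/setI_n0P; exists u => //; apply: (subsetP sU).
by apply/setI_n0P; exists v => //; apply: (subsetP sV).
Qed.

Lemma crossing2 u v A B : u != v -> u \in A -> v \in B -> crossing (supp A) (supp B) [set u; v].
Proof.
move=> uv uA vB; rewrite /crossing cards2 uv; apply/and3P; split=> //; apply/setI_n0P.
  by exists u; rewrite !inE ?eqxx.
by exists v; rewrite !inE ?eqxx ?orbT.
Qed.

Lemma supp_sub A B : {subset A <= B} -> supp A \subset supp B.
Proof. by move=> h; apply/subsetP => x; rewrite !inE => /h. Qed.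

Lemma reach_sing_neq s x y ps qs Q : reach s (sing [:: x; y] ++ ps) qs Q -> x != y.
Proof. by move/reach_sing_uniq; rewrite /= inE andbT. Qed.

(** The arcs [R] and [RA] consist of untouched fixed points and lose two points at each swap; seeds
    already made stay inside the growing [K'] and [KA']. *)
Lemma seeds_even s k K R KA RA ps qs Q :
  reach s (sing (RA ++ R) ++ ps) ((K ++ R) :: (KA ++ RA) :: qs) Q ->
  2 * k <= size RA -> 2 * k <= size R ->
  exists K' R' KA' RA' D, [/\
    reach s (D ++ sing (RA' ++ R') ++ ps) ((K' ++ R') :: (KA' ++ RA') :: qs) Q,
    [/\ size RA' + 2 * k = size RA, size R' + 2 * k = size R,
        size (KA' ++ RA') = size (KA ++ RA) & size (K' ++ R') = size (K ++ R)],
    size D = 2 * k, all (crossing (supp KA') (supp K')) D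
    & {subset K <= K'} /\ {subset KA <= KA'}].
Proof.
elim: k K R KA RA ps => [|k IH] K R KA RA ps R0 hA hR.
  by exists K, R, KA, RA, [::]; rewrite muln0 !addn0; split=> //; split.
case: RA R0 hA => [|a1 [|a2 RA]] R0 hA; [by move: hA => /=; lia..|].
case: R R0 hR => [|b1 [|b2 R]] R0 hR; [by move: hR => /=; lia..|].
have R1 : reach s (sing [:: a1; b1; a2; b2] ++ sing (RA ++ R) ++ ps)
    ((K ++ b1 :: b2 :: R) :: (KA ++ a1 :: a2 :: RA) :: qs) Q.
  by apply: reach_perml R0; sing_perm.
have n1 : a1 != b1 by exact: (@reach_sing_neq s _ _ (sing [:: a2; b2] ++ sing (RA ++ R) ++ ps) _ Q R1).
have n2 : b2 != a2.
  apply: (@reach_sing_neq s _ _ (sing [:: a1; b1] ++ sing (RA ++ R) ++ ps) _ Q).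
  by apply: reach_perml R1; sing_perm.
have R2 := seed_swap R1.
have {}R2 : reach s (sing (RA ++ R) ++ ([set a1; b1] :: [set a2; b2] :: ps))
   (((K ++ [:: a1; b2]) ++ R) :: ((KA ++ [:: b1; a2]) ++ RA) :: qs) Q.
  by rewrite -!catA; apply: reach_perml R2; sing_perm.
have [||K' [R' [KA' [RA' [D [R3 [z1 z2 z3 z4] sD aD [sK sKA]]]]]]] := IH _ _ _ _ _ R2.
- by move: hA => /=; lia.
- by move: hR => /=; lia.
exists K', R', KA', RA', (D ++ [:: [set b1; a1]; [set a2; b2]]); split.
- by apply: reach_perml R3; rewrite (setUC [set b1]); perm_by_count.
- by move: z1 z2 z3 z4; rewrite !size_cat /=; split; lia.
- by rewrite size_cat /= sD; lia.
- rewrite all_cat aD /= !andbT; apply/andP; split; last rewrite setUC.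
    by apply: crossing2; [rewrite eq_sym|apply: sKA|apply: sK]; rewrite // mem_cat !inE eqxx ?orbT.
  by rewrite setUC; apply: crossing2; [rewrite eq_sym|apply: sKA|apply: sK]; rewrite // mem_cat !inE eqxx ?orbT.
- by split=> v vK; [apply: sK|apply: sKA]; rewrite mem_cat vK.
Qed.

(* [theta] is the length up to which cycles count as short; only short ones can
   afford a clean arc of their own length inside R. *)
Definition seedable theta a c :=
  ~~ odd c && (c <= a) || odd c && ((c <= a <= theta) || (3 <= c) && (c.+2 <= a)).

(** Each orbit of size 2 costs one transposition, and keeping the number of cycles of [s * t]
    requires an even number of them; for odd [c] the list [F] supplies the missing one, which only
    has to meet the long cycle. *)
Lemma seeds s theta c K R A SK ps qs Q :
  reach s (sing (A ++ R ++ SK) ++ ps) ((K ++ R) :: A :: qs) Q ->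
  seedable theta (size A) c -> theta + c + 10 <= size R -> {subset SK <= K} ->
  exists K' R' A' SK' SA D F, [/\
    reach s (D ++ F ++ sing SA ++ sing (R' ++ SK') ++ ps) ((K' ++ R') :: A' :: qs) Q,
    [/\ size A' = size A, size (K' ++ R') = size (K ++ R), size SA + c = size A
      & size R <= size R' + (theta + c + 10)],
    [/\ size D = c, size F = odd c, all (crossing (supp A') (supp K')) D
      & all (fun X : {set T} => (#|X| == 2) && (X :&: supp K' != set0)) F],
    {subset K <= K'} & {subset SK' <= K'} /\ {subset SA <= A'}].
Proof.
rewrite /seedable => R0 + hR sSK; case oc: (odd c) => /=; rewrite ?orbF; last first.
  have cE : c = 2 * c./2 by rewrite mul2n -[LHS]odd_double_half oc.
  move=> ca.
  have {}R0 : reach s (sing (A ++ R) ++ (sing SK ++ ps)) ((K ++ R) :: ([::] ++ A) :: qs) Q.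
    by apply: reach_perml R0; sing_perm.
  have [||K' [R' [KA' [RA' [D [R3 [z1 z2 z3 z4] sD aD [sK sKA]]]]]]] := seeds_even (k := c./2) R0.
  - by move: ca cE; clear; lia.
  - by move: hR cE; clear; lia.
  exists K', R', (KA' ++ RA'), SK, RA', D, [::]; split.
  - by apply: reach_perml R3; sing_perm.
  - by split=> //; move: z1 z2 cE; clear; lia.
  - split=> //; first by rewrite sD -cE.
    apply: sub_all aD => X; apply: crossingS => //; apply: supp_sub => v vK.
    by rewrite mem_cat vK.
  - exact: sK.
  - by split=> v h; [apply: sK; apply: sSK|rewrite mem_cat h orbT].
case/orP=> [/andP[ca ath]|/andP[c3 ca]].
  case: A R0 ca ath => [|x A] R0 ca ath; first by move: ca oc; rewrite leqn0 => /eqP ->.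
  case: R R0 hR => [|y R] R0 hR; first by move: hR => /=; lia.
  have sZ : size A < size R by move: hR ath => /=; lia.
  have [Z [R1 [RE ZE]]] : exists Z R1, R = Z ++ R1 /\ size Z = (size A).+1.
    by exists (take (size A).+1 R), (drop (size A).+1 R); rewrite cat_take_drop size_takel.
  case: Z RE ZE => [|z Z] //= RE [ZE].
  case: R1 RE => [|w R1] RE.
    by move: hR ath; rewrite RE /= cats0 ZE; lia.
  have {}R0 : reach s (sing [:: y; x; z; w] ++ (sing (Z ++ R1) ++ sing (A ++ SK) ++ ps))
       ((K ++ y :: z :: Z ++ w :: R1) :: (x :: A) :: qs) Q.
    by rewrite RE in R0; apply: reach_perml R0; sing_perm.
  have n1 : y != x by exact: (@reach_sing_neq s _ _ (sing [:: z; w] ++ sing (Z ++ R1) ++ sing (A ++ SK) ++ ps) _ Q R0).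
  have n2 : z != w.
    apply: (@reach_sing_neq s _ _ (sing [:: y; x] ++ sing (Z ++ R1) ++ sing (A ++ SK) ++ ps) _ Q).
    by apply: reach_perml R0; sing_perm.
  have R2 := seed_cut R0.
  have {}R2 : reach s (sing (Z ++ R1) ++ ([set z; w] :: [set y; x] :: sing (A ++ SK) ++ ps))
     (((K ++ x :: A ++ [:: y; w]) ++ R1) :: ([:: z] ++ Z) :: qs) Q.
    have -> : (K ++ x :: A ++ [:: y; w]) ++ R1 = K ++ x :: A ++ y :: w :: R1 by list_eq.
    by apply: reach_perml R2; sing_perm.
  have cE : c = (2 * c./2).+1 by rewrite mul2n -[LHS]odd_double_half oc.
  have [||K' [R' [KA' [RA' [D [R3 [z1 z2 z3 z4] sD aD [sK sKA]]]]]]] := seeds_even (k := c./2) R2.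
  - by move: ca cE => /=; rewrite ZE; clear; lia.
  - by move: hR ath cE; rewrite RE /= !size_cat /= ZE; clear; lia.
  exists K', R', (KA' ++ RA'), (A ++ SK), RA', ([set z; w] :: D), [:: [set y; x]]; split.
  - by apply: reach_perml R3; sing_perm.
  - split.
    + by rewrite z3 /= ZE.
    + by rewrite z4 RE /= !size_cat /= size_cat /= size_cat /= ZE; lia.
    + by move: z1 cE; rewrite /= ZE; clear; lia.
    + by move: z2 cE ath; rewrite RE /= !size_cat /= ZE; clear; lia.
  - split=> //=; first by rewrite sD -cE.
    + rewrite crossing2 //; last by apply: sK; rewrite mem_cat inE mem_cat !inE ?eqxx ?orbT.
        apply: sub_all aD => X; apply: crossingS => //; apply: supp_sub => v vK.
        by rewrite mem_cat vK.
      by rewrite mem_cat sKA // mem_head.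
    + rewrite cards2 n1 /= andbT; apply/setI_n0P; exists x; rewrite !inE ?eqxx ?orbT //.
      by apply: sK; rewrite mem_cat mem_head orbT.
  - by move=> v vK; apply: sK; rewrite mem_cat vK.
  - split=> v; last by move=> h; rewrite mem_cat h orbT.
    rewrite mem_cat => /orP[vA|/sSK vK]; apply: sK; rewrite mem_cat ?vK //.
    by rewrite inE mem_cat vA !orbT.
have [A1 [x2 AE]] : exists A1 x2, A = rcons A1 x2.
  by case/lastP: A ca {R0} => [|A1 x2] //; exists A1, x2.
case: A1 AE => [|x1 [|w [|y [|z P]]]] AE; rewrite AE /= in ca; try lia.
case: R R0 hR => [|y2 [|u1 [|u2 [|y1 [|x R]]]]] R0 hR; try by move: hR => /=; lia.
have {}R0 : reach s (sing [:: x1; y1; x2; y2; y; x; z; w] ++ (sing (P ++ R) ++ sing [:: u1; u2] ++ sing SK ++ ps))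
   ((K ++ y2 :: u1 :: u2 :: y1 :: x :: R) :: (x1 :: w :: y :: z :: P ++ [:: x2]) :: qs) Q.
  by rewrite AE /= cats1 in R0 *; apply: reach_perml R0; rewrite -cats1; sing_perm.
have U8 : uniq [:: x1; y1; x2; y2; y; x; z; w] by apply: reach_sing_uniq R0.
have R2 := seed_exchange R0.
have {}R2 : reach s (sing (P ++ R) ++ ([set z; w] :: [set x2; y2] :: [set x1; y1] :: [set y; x] :: sing [:: u1; u2] ++ sing SK ++ ps))
   (((K ++ [:: x2; y1; y; w; x]) ++ R) :: ([:: y2; u1; u2; x1; z] ++ P) :: qs) Q.
  by apply: reach_perml R2; sing_perm.
(* [seed_exchange] makes three crossing orbits at once, and swaps supply the other [c - 3]. It
   leaves only the [size A - 5] points of [P] for them, whence the condition [c.+2 <= a] in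
   [seedable]. *)
have cE : c = (2 * (c./2).-1).+3 by rewrite -[LHS]odd_double_half oc -mul2n; lia.
rewrite size_rcons in ca.
have [||K' [R' [KA' [RA' [D [R3 [z1 z2 z3 z4] sD aD [sK sKA]]]]]]] := seeds_even (k := (c./2).-1) R2.
- by move: ca cE; clear; lia.
- by move: hR cE => /=; clear; lia.
exists K', R', (KA' ++ RA'), SK, ([:: u1; u2] ++ RA'), ([set z; w] :: [set x2; y2] :: [set x1; y1] :: D), [:: [set y; x]]; split.
- by apply: reach_perml R3; sing_perm.
- split.
  + by rewrite z3 AE /= size_rcons.
  + by rewrite z4 !size_cat /=; lia.
  + by rewrite AE /= size_rcons; move: z1 ca cE; clear; lia.
  + by move: z2 cE => /=; clear; lia.
- have inK v : v \in [:: x2; y1; y; w; x] -> v \in K' by move=> h; apply: sK; rewrite mem_cat h orbT.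
  have inA v : v \in [:: y2; u1; u2; x1; z] -> v \in KA' ++ RA' by move=> /sKA h; rewrite mem_cat h.
  have [n1 n2 n3 n4] : [/\ z != w, y2 != x2, x1 != y1 & y != x].
    rewrite (eq_sym y2); rewrite /= !inE in U8; split.
    + by case: (z == w) U8; rewrite /= ?(orbT, andbF).
    + by case: (x2 == y2) U8; rewrite /= ?(orbT, andbF).
    + by case: (x1 == y1) U8; rewrite /= ?(orbT, andbF).
    + by case: (y == x) U8; rewrite /= ?(orbT, andbF).
  split=> //=; first by rewrite sD {2}cE.
  + rewrite crossing2 ?inA ?inK ?inE ?eqxx ?orbT // (setUC [set x2]) crossing2 ?inA ?inK ?inE ?eqxx ?orbT //.
    rewrite crossing2 ?inA ?inK ?inE ?eqxx ?orbT //=.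
    apply: sub_all aD => X; apply: crossingS => //; apply: supp_sub => v vK.
    by rewrite mem_cat vK.
  + rewrite cards2 n4 /= andbT; apply/setI_n0P; exists x; rewrite !inE ?eqxx ?orbT //.
    by apply: inK; rewrite !inE eqxx !orbT.
- by move=> v vK; apply: sK; rewrite mem_cat vK.
- split=> v h; first by apply: sK; rewrite mem_cat sSK.
  move: h; rewrite mem_cat => /orP[h|h]; rewrite mem_cat ?h ?orbT // sKA //.
  by move: h; rewrite !inE => /orP[] ->; rewrite ?orbT.
Qed.

End Seeds.

(** * Filling all cycles but the longest *)

(* A plan for one cycle of length a: the list p.1 of parts placed entirely inside
   it, and the list p.2 of the numbers of points it gives to crossing parts. *)
Definition plan_ok theta a (p : seq nat * seq nat) :=
  [&& sumn p.1 + sumn p.2 == a, all odd p.2, odd (sumn p.1) == odd (size p.1),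
      all (leq 1) p.1 & seedable theta a (size p.2)].

(* A piece of r points in the cycle becomes an orbit of size r.+1 with one point in the
   longest cycle; an odd number of pieces costs an extra orbit of size 2 there. *)
Definition open_sizes (p : seq nat * seq nat) : seq nat :=
  map succn p.2 ++ nseq (odd (size p.2)) 2.

Lemma sumn_pred_odd rs : all odd rs ->
  sumn (map predn rs) + size rs = sumn rs /\ ~~ odd (sumn (map predn rs)).
Proof.
elim: rs => //= r rs IH /andP[or /IH[h1 h2]]; case: r or => //= r or.
by rewrite oddD (negbTE h2) addbF or; split=> //; lia.
Qed.

Section FillAll.
Variable T : finType.
Implicit Types (s t : {perm T}) (x y z : T) (A B K R P l S : seq T) (qs : seq (seq T)).
Implicit Types (X Y q : {set T}) (ps Q : seq {set T}).

Lemma blocks_cat (gs hs : seq ({set T} * nat)) : blocks (gs ++ hs) = blocks gs ++ blocks hs.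
Proof. by rewrite /blocks filter_cat map_cat. Qed.

Lemma blocks_old (D : seq {set T}) (es : seq nat) : size D = size es ->
  all (fun X => X != set0) D -> blocks (zip D es) = D.
Proof.
elim: D es => [|X D IH] [|e es] //= [sz] /andP[nX nD].
by rewrite /blocks /= nX /= -/(blocks _) IH.
Qed.

Lemma blocks_fresh (M : seq nat) : blocks [seq (set0 : {set T}, m) | m <- M] = [::].
Proof. by elim: M => //= m M IH; rewrite /blocks /= eqxx. Qed.

Lemma absorbed_zip q D es Ws : size D = size es ->
  all2 (absorbed q) (zip D es) Ws ->
  [seq #|X| | X : {set T} <- Ws] = [seq #|p.1| + p.2 | p : {set T} * nat <- zip D es] /\
  forall V : {set T}, all (fun X : {set T} => X :&: V != set0) D ->
     all (fun X : {set T} => X :&: V != set0) Ws.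
Proof.
elim: D es Ws => [|X D IH] [|e es] [|W Ws] //= [sz] /andP[/and3P[/= sub /eqP -> _] /(IH _ _ sz)[-> h]].
split=> // V /andP[n /h ->]; rewrite andbT.
case/setI_n0P: n => v vX vV; apply/setI_n0P; exists v => //; exact: (subsetP sub).
Qed.

Lemma absorbed_fresh q (M : seq nat) Ws :
  all2 (absorbed q) [seq (set0 : {set T}, m) | m <- M] Ws ->
  [seq #|X| | X : {set T} <- Ws] = M /\ all (fun X : {set T} => X :&: q != set0) Ws.
Proof.
elim: M Ws => [|m M IH] [|W Ws] //= /andP[/and3P[/= _ /eqP -> n] /IH[-> ->]].
by rewrite cards0 add0n n.
Qed.

(** [BL] collects the orbits left open, each with a point in the longest cycle, and [NL] the
    finished ones. The cost hypothesis pays for the points of [R] that the seeds of each short cycle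
    consume. *)
Lemma fill_all s theta As plans K R SK ps Q :
  all2 (fun A p => plan_ok theta (size A) p) As plans ->
  sumn [seq theta + size p.2 + 10 | p : seq nat * seq nat <- plans] <= size R ->
  {subset SK <= K} ->
  reach s (sing (flatten As ++ R ++ SK) ++ ps) ((K ++ R) :: As) Q ->
  exists K' R' SK' BL NL QA, [/\
    reach s (sing (R' ++ SK') ++ BL ++ NL ++ ps) [:: K' ++ R'] (QA ++ Q),
    size (K' ++ R') = size (K ++ R) /\ perm_eq [seq #|X| | X : {set T} <- QA] (map size As),
    perm_eq [seq #|X| | X : {set T} <- BL] (flatten (map open_sizes plans)) /\
    all (fun X : {set T} => X :&: supp K' != set0) BL,
    perm_eq [seq #|X| | X : {set T} <- NL] (flatten (map fst plans))
    & {subset K <= K'} /\ {subset SK' <= K'}].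
Proof.
elim: As plans K R SK ps Q => [|A As IH] [|[M rs] plans] K R SK ps Q //=.
  by move=> _ _ sSK R0; exists K, R, SK, [::], [::], [::]; split=> //; split.
case/andP=> /and5P[/= /eqP szA ars /eqP oM M0 sd] ok cost sSK R0.
have {}R0 : reach s (sing (A ++ R ++ SK) ++ (sing (flatten As) ++ ps)) ((K ++ R) :: A :: As) Q.
  by apply: reach_perml R0; sing_perm.
have cR : theta + size rs + 10 <= size R by apply: leq_trans cost; apply: leq_addr.
have [K1 [R1 [A1 [SK1 [SA [D [F [R2 [z1 z2 z3 z4] [zD zF aD aF] sK1 [sSK1 sSA]]]]]]]]] := seeds R0 sd cR sSK.
have uA1 : uniq A1.
  by have := reach_uniq R2; rewrite [flatten _]/= !cat_uniq => /and3P[_ _ /and3P[]].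
have {}R2 := reach_store (reach_swap R2).
have [sp1 sp2] := sumn_pred_odd ars.
have zD' : size D = size (map predn rs) by rewrite size_map.
have nD : all (fun X => X != set0) D.
  by apply: sub_all aD => X /and3P[/eqP c _ _]; rewrite -card_gt0 c.
(* A crossing orbit already owns one of its [r] points in this cycle and asks for [r.-1] more, an
   even number; without odd old demands, [fill] needs no spare points. *)
pose gs := zip D (map predn rs) ++ [seq (set0 : {set T}, m) | m <- M].
have fD : count (@fresh T) (zip D (map predn rs)) = 0.
  elim: (D) (map predn rs) zD' nD => [|X D' IH'] [|e es] //= [sz] /andP[nX nD'].
  by rewrite IH' // /fresh /= (negbTE nX).
have [|Ws RW] := @fill T s (supp A1) gs SA (F ++ sing (R1 ++ SK1) ++ sing (flatten As) ++ ps) ((K1 ++ R1) :: As) Q.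
  split; first split.
  - by rewrite /gs blocks_cat blocks_fresh cats0 blocks_old //; apply: reach_perml R2; sing_perm.
  - rewrite /gs all_cat; apply/andP; split; last first.
      by apply/allP=> g /mapP[m mM ->]; rewrite /groupable /= eqxx (allP M0 _ mM) orbT.
    elim: (D) (map predn rs) zD' aD => [|X D' IH'] [|e es] //= [sz] /andP[/and3P[_ nX _] nD'].
    by rewrite IH' // /groupable /= nX.
  - by apply/allP => x /sSA xA; rewrite inE /= inE.
  - rewrite /gs map_cat sumn_cat.
    have -> : map snd (zip D (map predn rs)) = map predn rs by apply: unzip2_zip; rewrite zD'.
    rewrite -map_comp map_id; move: sp1 szA z3; clear; lia.
  - have -> : size SA = sumn (map predn rs) + sumn M by move: sp1 szA z3; clear; lia.
    rewrite oddD (negbTE sp2) oM /gs count_cat fD count_map /= add0n.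
    by rewrite (eq_count (a2 := predT)) ?count_predT // => m; rewrite /fresh /= eqxx.
  left; rewrite /gs count_cat.
  have -> : count (@oddold T) [seq (set0 : {set T}, m) | m <- M] = 0.
    by rewrite count_map; apply/eqP; rewrite -leqn0 leqNgt -has_count; apply/hasPn => m _; rewrite /= /oddold /= eqxx.
  have -> // : count (@oddold T) (zip D (map predn rs)) = 0.
  elim: (D) (rs) ars zD' => [|X D' IH'] [|r rs'] //= /andP[or ors] [sz].
  rewrite IH' // /oddold /= addn0; case: r or => //= r /negbTE ->; by rewrite andbF.
move=> aW; case/all2_catP: aW RW => WD [WM [-> /(absorbed_zip zD')[cWD mWD] /absorbed_fresh[cWM _]]] RW.
have {}RW : reach s (sing (flatten As ++ R1 ++ SK1) ++ (WD ++ F ++ WM ++ ps))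
    ((K1 ++ R1) :: As) (supp A1 :: Q) by apply: reach_perml RW; sing_perm.
have cost1 : sumn [seq theta + size p.2 + 10 | p : seq nat * seq nat <- plans] <= size R1.
  by move: cost z4; clear; lia.
have [K2 [R2' [SK2 [BL [NL [QA [R3 [y1 y2] [y3 y4] y5 [y6 y7]]]]]]]] := IH _ _ _ _ _ _ ok cost1 sSK1 RW.
have mono : forall X : {set T}, X :&: supp K1 != set0 -> X :&: supp K2 != set0.
  move=> X /setI_n0P[v vX vK]; apply/setI_n0P; exists v => //.
  exact: (subsetP (supp_sub y6)).
exists K2, R2', SK2, (WD ++ F ++ BL), (WM ++ NL), (supp A1 :: QA); split.
- have : perm_eq (QA ++ supp A1 :: Q) ((supp A1 :: QA) ++ Q) by perm_by_count.
  by move/reach_permr; apply; apply: reach_perml R3; sing_perm.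
- split; first by rewrite y1.
  by rewrite /= card_supp // z1 perm_cons.
- have eD : [seq #|X| | X : {set T} <- D] = nseq (size D) 2.
    by elim: (D) aD => //= X D' IHD /andP[/and3P[/eqP -> _ _] /IHD ->].
  have eF : [seq #|X| | X : {set T} <- F] = nseq (size F) 2.
    by elim: (F) aF => //= X D' IHD /andP[/andP[/eqP -> _] /IHD ->].
  split.
    rewrite !map_cat cWD eF zF /open_sizes /= -catA.
    have -> : [seq #|p.1| + p.2 | p : {set T} * nat <- zip D (map predn rs)] = map succn rs.
      elim: (D) (rs) ars zD' eD => [|X D' IHD] [|r rs'] //= /andP[or ors] [sz] [-> eD'].
      by rewrite IHD //; case: r or.
    by rewrite !perm_cat2l.
  rewrite !all_cat y4 andbT; apply/andP; split.
    apply: sub_all (mWD (supp K1) _); first exact: mono.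
    by apply: sub_all aD => X /and3P[].
  by apply: sub_all aF => X /andP[_ /mono].
- by rewrite map_cat cWM /= perm_cat2l.
- by split=> // v /sK1/y6.
Qed.

End FillAll.

(** * Realizing a distribution of the parts *)

Section Realize.
Variable T : finType.
Implicit Types (s t : {perm T}) (x y z : T) (A B K R P l S : seq T) (qs : seq (seq T)).
Implicit Types (X Y q : {set T}) (ps Q : seq {set T}).

(** Merging three orbits into one keeps the cycle and lowers their number by two, so an odd number
    comes down to one. *)
Lemma reach_merge_odd s W ps qs q Q : odd (size W) ->
  all (fun X => X :&: q != set0) W -> reach s (W ++ ps) qs (q :: Q) ->
  exists2 V, reach s (V :: ps) qs (q :: Q)
    & #|V| = sumn [seq #|X| | X : {set T} <- W].
Proof.
move=> oW aW R0.
have [V R1] : exists V, reach s (V :: ps) qs (q :: Q).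
  have [n] := ubnP (size W); elim: n W oW aW R0 => // n IH [|X [|Y [|Z W]]] //= oW.
    by move=> _ R0 _; exists X.
  case/and4P=> nX nY nZ aW R0 sW; apply: (IH (X :|: Y :|: Z :: W)).
  - by move: oW => /=; rewrite negbK.
  - rewrite /= aW andbT; case/setI_n0P: nX => x xX xq.
    by apply/setI_n0P; exists x; rewrite // !inE xX.
  - exact: reach_join3 R0.
  - by move: sW => /=; clear; lia.
exists V => //; have := reach_sum R0; have := reach_sum R1.
by rewrite map_cat sumn_cat /=; clear; lia.
Qed.

Lemma reach_merge_groups s cs W ps qs q Q : all (fun c => odd (size c)) cs ->
  all (fun X => X :&: q != set0) W -> [seq #|X| | X : {set T} <- W] = flatten cs ->
  reach s (W ++ ps) qs (q :: Q) ->
  exists2 Vs, reach s (Vs ++ ps) qs (q :: Q) & [seq #|X| | X : {set T} <- Vs] = map sumn cs.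
Proof.
elim: cs W ps => [|c cs IH] W ps /=; first by case: W => // _ _ _ R0; exists [::].
case/andP=> oc ocs aW cW R0.
have [W1 [W2 [WE c1 c2]]] : exists W1 W2, [/\ W = W1 ++ W2,
    [seq #|X| | X : {set T} <- W1] = c & [seq #|X| | X : {set T} <- W2] = flatten cs].
  exists (take (size c) W), (drop (size c) W); rewrite cat_take_drop map_take map_drop cW.
  by rewrite take_size_cat // drop_size_cat.
move: aW R0; rewrite WE all_cat -catA => /andP[a1 a2] R0.
have [|V R1 cV] := @reach_merge_odd s W1 (W2 ++ ps) qs q Q _ a1 R0.
  by rewrite -(size_map (fun X : {set T} => #|X|)) c1.
have {}R1 : reach s (W2 ++ (V :: ps)) qs (q :: Q) by apply: reach_perml R1; perm_by_count.
have [Vs R2 cVs] := IH _ _ ocs a2 c2 R1.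
exists (V :: Vs); last by rewrite /= cV c1 cVs.
by apply: reach_perml R2; perm_by_count.
Qed.

Lemma map_card_supp (ss : seq (seq T)) : uniq (flatten ss) ->
  [seq #|X| | X : {set T} <- map supp ss] = map size ss.
Proof.
elim: ss => //= l ss IH; rewrite cat_uniq => /and3P[ul _ us].
by rewrite card_supp // IH.
Qed.

(** Turns a distribution of numbers into permutations. The longest cycle is filled last, because
    only there may many open orbits have odd demands. *)
Lemma realize s t B As tt theta plans sm cuts es ms :
  cycrep s (B :: As) -> cycrep t tt -> ~~ odd_perm t ->
  all2 (fun A p => plan_ok theta (size A) p) As plans ->
  perm_eq (map size tt) (flatten (map fst plans) ++ sm ++ map sumn cuts) ->
  all (fun c => odd (size c)) cuts ->
  size es = size (flatten (map open_sizes plans)) ->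
  perm_eq (sm ++ flatten cuts)
    ([seq p.1 + p.2 | p <- zip (flatten (map open_sizes plans)) es] ++ ms) ->
  all (leq 1) ms ->
  sumn [seq theta + size p.2 + 10 | p : seq nat * seq nat <- plans] <= size B ->
  2 * size es + 3 <= sumn es + sumn ms ->
  exists u, (exists g, u = (t ^ g)%g) /\ (exists g, (s * u)%g = (s ^ g)%g).
Proof.
move=> rs rt ot ok p_tt odd_cuts sz_es p_parts ms0 cost many.
set bs := flatten (map open_sizes plans) in sz_es p_parts *.
have p0 : perm_eq [seq [set x : T] | x <- enum T] (sing (flatten As ++ B ++ [::]) ++ [::]).
  have [pe _ _] := and3P rs; rewrite cats0 cats0; apply: perm_map; rewrite perm_sym.
  by apply: perm_trans pe; rewrite perm_catC.
have R0 := reach_perml p0 (reach_start rs).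
have nil_sub : {subset ([::] : seq T) <= ([::] : seq T)} by [].
have [K' [R' [SK' [BL [NL [QA [R1 [szB pQA] [pBL mBL] pNL [_ sSK]]]]]]]] :=
  fill_all ok cost nil_sub (R0 : reach s _ (([::] ++ B) :: As) _).
have uB : uniq (K' ++ R') by have := reach_uniq R1; rewrite /= cats0.
have {}R1 := reach_store R1.
rewrite -/bs in pBL.
have [BL' pBL' cBL] := perm_map_lift pBL.
have mBL' : all (fun X : {set T} => X :&: supp (K' ++ R') != set0) BL'.
  rewrite -(perm_all _ pBL'); apply: sub_all mBL => X /setI_n0P[v vX vK].
  apply/setI_n0P; exists v => //; apply: (subsetP (supp_sub _)) vK => w wK.
  by rewrite mem_cat wK.
have szBL : size BL' = size es by rewrite sz_es -cBL size_map.
set S := R' ++ SK' in R1.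
have SB : all (mem (supp (K' ++ R'))) S.
  by apply/allP => x; rewrite mem_cat inE /= inE mem_cat => /orP[->|/sSK ->]; rewrite ?orbT.
clearbody S; pose gs := zip BL' es ++ [seq (set0 : {set T}, m) | m <- ms].
have {}R1 : reach s (sing S ++ BL' ++ NL) [::] (supp (K' ++ R') :: QA).
  rewrite cats0 in R1; rewrite cats0 in R1.
  by apply: reach_perml R1; rewrite perm_cat2l perm_cat2r.
have szQA : size QA = size As by move/perm_size: pQA; rewrite !size_map.
have par := reach_parity R1 (_ : _ = _); rewrite /= szQA (cycrep_size rs) in par.
have {}par := par erefl.
have sumS : size S = sumn es + sumn ms.
  have := reach_sum R1; rewrite !map_cat !sumn_cat cBL.
  have -> : sumn [seq #|X| | X : {set T} <- NL] = sumn (flatten (map fst plans)) by apply: perm_sumn.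
  have -> : sumn [seq #|X| | X : {set T} <- sing S] = size S.
    by rewrite /sing -map_comp; elim: (S) => //= x S' ->; rewrite cards1.
  have := sumn_card_supp (cycrep_uniq rt); rewrite (map_card_supp (cycrep_uniq rt)) (perm_sumn p_tt) !sumn_cat.
  have [/perm_size -> _ _] := and3P rt; rewrite -cardE => e1 e2.
  have := perm_sumn p_parts; rewrite !sumn_cat sumn_flatten => e3.
  have e4 : sumn [seq p.1 + p.2 | p <- zip bs es] = sumn bs + sumn es.
    move: sz_es; clear; elim: (bs) es => [|b bs' IH] [|e es] //= [sz]; rewrite (IH _ sz).
    by clear; lia.
  move: e1 e2; rewrite e3 e4 => <-; clear; move: (sumn (flatten _)) (sumn bs) (sumn es) (sumn ms) (size S) => a b c d e.
  by lia.
(* Evenness of [t] ties [#|T|] modulo 2 to the number of parts, and [reach_parity] ties it to the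
   current number of orbits; cutting parts into odd numbers of pieces does not affect the count. *)
have parS : odd (size S) = odd (size ms).
  have e1 := cycrep_odd rt; rewrite (negbTE ot) in e1.
  have e2 := perm_size p_tt; rewrite !size_cat !size_map in e2.
  have e3 := perm_size p_parts; rewrite !size_cat size_map size_zip sz_es minnn in e3.
  have e4 : odd (size (flatten cuts)) = odd (size cuts).
    move: odd_cuts; clear; elim: cuts => //= c cs IH /andP[oc /IH].
    by rewrite size_cat oddD oc => ->.
  have e5 := perm_size pNL; rewrite size_map in e5.
  move: par; rewrite !size_cat /sing size_map -/(sing _) szBL sz_es -/bs e5 => par.
  have {e1}e1 : odd #|T| = odd (size tt) by move: e1; case: (odd #|T|); case: (odd _).
  have {}e3 := congr1 odd e3; have {}e2 := congr1 odd e2.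
  move: e1 e2 e3 e4 par; rewrite !oddD; clear.
  move: (odd #|T|) (odd (size tt)) (odd (size (flatten (map fst plans)))) (odd (size sm))
    (odd (size (flatten cuts))) (odd (size cuts)) (odd (size bs)) (odd (size ms)) (odd (size S)).
  by do 9 case.
have [|Ws RW aW] := @fill T s (supp (K' ++ R')) gs S NL [::] QA.
  split; first split.
  - rewrite /gs blocks_cat blocks_fresh cats0 blocks_old //.
      by apply: reach_perml R1; perm_by_count.
    apply: sub_all mBL' => X; apply: contraNneq => ->; by rewrite set0I.
  - rewrite /gs all_cat; apply/andP; split; last first.
      by apply/allP=> g /mapP[m mM ->]; rewrite /groupable /= eqxx (allP ms0 _ mM) orbT.
    elim: (BL') (es) szBL mBL' => [|X D' IH'] [|e es'] //= [sz] /andP[nX nD'].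
    by rewrite IH' // /groupable /= nX.
  - exact: SB.
  - rewrite /gs map_cat sumn_cat sumS.
    have -> : map snd (zip BL' es) = es by apply: unzip2_zip; rewrite szBL.
    by rewrite -map_comp map_id.
  - rewrite parS /gs count_cat.
    have -> : count (@fresh T) (zip BL' es) = 0.
      elim: (BL') (es) szBL mBL' => [|X D' IH'] [|e es'] //= [sz] /andP[nX nD'].
      rewrite IH' // /fresh /= (_ : (X == set0) = false) //.
      by apply: contraNF nX => /eqP ->; rewrite set0I.
    by rewrite count_map (eq_count (a2 := predT)) ?count_predT // => m; rewrite /fresh /= eqxx.
  (* Up to [size es] old demands may be odd here; [many] provides the spare points. *)
  right; rewrite sumS; apply: leq_trans many; rewrite leq_add2r leq_mul2l /=.
  rewrite /gs count_cat.
  have -> : count (@oddold T) [seq (set0 : {set T}, m) | m <- ms] = 0.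
    by rewrite count_map; apply/eqP; rewrite -leqn0 leqNgt -has_count; apply/hasPn => m _; rewrite /= /oddold /= eqxx.
  by rewrite addn0; apply: leq_trans (count_size _ _) _; rewrite size_zip geq_minr.
have mW : all (fun X : {set T} => X :&: supp (K' ++ R') != set0) Ws.
  by elim: (gs) (Ws) aW => [|g gs' IH] [|W Ws'] //= /andP[/and3P[_ _ ->] /IH].
case/all2_catP: aW RW mW => WD [WM [-> /(absorbed_zip szBL)[cWD _] /absorbed_fresh[cWM _]]] RW mW.
(* An uncut part counts as a group of one piece, so all parts are glued alike. *)
have cW : perm_eq [seq #|X| | X : {set T} <- WD ++ WM] (flatten ([seq [:: m] | m <- sm] ++ cuts)).
  rewrite flatten_cat flatten_map1 map_id perm_sym; apply: perm_trans p_parts _.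
  rewrite map_cat cWD cWM perm_cat2r -cBL.
  suff -> : [seq p.1 + p.2 | p <- zip [seq #|X| | X : {set T} <- BL'] es] =
            [seq #|p.1| + p.2 | p : {set T} * nat <- zip BL' es] by [].
  by elim: (BL') (es) => [|X D' IH'] [|e es'] //=; rewrite IH'.
have [W' pW' cW'] := perm_map_lift cW.
rewrite (perm_all _ pW') in mW.
have {}RW : reach s (W' ++ NL) [::] (supp (K' ++ R') :: QA).
  by apply: reach_perml RW; rewrite perm_cat2r.
have ocs : all (fun c : seq nat => odd (size c)) ([seq [:: m] | m <- sm] ++ cuts).
  by rewrite all_cat odd_cuts andbT; apply/allP=> c /mapP[x _ ->].
have [Vs [u [Dl [[uu ru pu] rsu pD]]] cV] := reach_merge_groups ocs mW cW' RW.
exists u; split.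
  apply: (cycrep_conj rt ru); rewrite perm_sym -(map_card_supp (cycrep_uniq ru)).
  rewrite perm_sym; apply: perm_trans p_tt _; rewrite perm_sym.
  apply: perm_trans (perm_map _ (_ : perm_eq _ (Vs ++ NL))) _; first by rewrite perm_sym.
  rewrite map_cat cV map_cat perm_catC; apply: perm_cat => //.
  by rewrite -map_comp (eq_map (g := id)) ?map_id // => m /=; rewrite addn0.
apply: (cycrep_conj rs rsu); rewrite -(map_card_supp (cycrep_uniq rsu)) perm_sym.
apply: perm_trans (perm_map _ (_ : perm_eq _ (supp (K' ++ R') :: QA))) _; first by rewrite perm_sym.
by rewrite /= card_supp // szB perm_cons.
Qed.

End Realize.

(** * Distributing the parts *)

(** Splitting off two pieces of size [L] at a time keeps the count odd; below [5 * L] the remainder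
    [p - 2 * L] is itself a valid piece. *)
Lemma cut_part L p : 0 < L -> 3 * L <= p ->
  exists c, [/\ sumn c = p, odd (size c) & all (fun v => L <= v < 3 * L) c].
Proof.
move=> L0; have [n] := ubnP p; elim: n p => // n IH p pn lp.
have [p5|p5] := ltnP p (5 * L).
  by exists [:: L; L; p - 2 * L]; split=> //=; first lia; apply/and4P; split=> //; lia.
have [||c [sc oc ac]] := IH (p - 2 * L); [lia|lia|].
exists [:: L, L & c]; split=> /=; first by rewrite sc; lia.
  by rewrite negbK.
by rewrite ac andbT; apply/andP; split; lia.
Qed.

Lemma cut_all L mu : 0 < L -> exists sm cuts,
  [/\ perm_eq mu (sm ++ map sumn cuts), all (fun p => p < 3 * L) sm,
      all (fun c => odd (size c)) cuts & all (fun v => L <= v < 3 * L) (flatten cuts)].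
Proof.
move=> L0; elim: mu => [|p mu [sm [cuts [h1 h2 h3 h4]]]]; first by exists [::], [::].
have [pL|pL] := ltnP p (3 * L).
  by exists (p :: sm), cuts; split=> //=; rewrite ?perm_cons // pL.
have [c [sc oc ac]] := cut_part L0 pL.
exists sm, (c :: cuts); split=> //=; rewrite ?oc ?all_cat ?ac //.
by rewrite perm_sym -cat1s perm_catCA /= sc perm_cons perm_sym.
Qed.

(** * Units and the greedy filling of short cycles *)

Lemma leq_sumn_size c s : all (leq c) s -> c * size s <= sumn s.
Proof. by elim: s => [|x s IH] /=; rewrite ?muln0 // => /andP[cx /IH h]; rewrite mulnS leq_add. Qed.

Lemma sumn_leq_size c s : all (fun x => x <= c) s -> sumn s <= c * size s.
Proof. by elim: s => [|x s IH] /=; rewrite ?muln0 // => /andP[cx /IH h]; rewrite mulnS leq_add. Qed.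

(* A unit (M, V) is a set of parts that is placed as a whole: either M is one odd
   part or a pair of even parts, or V is one piece of a cut part; the piece v gives
   the odd number [inner v] of its points to a cycle and keeps two or three outside. *)
Definition inner v := if odd v then v - 2 else v - 3.

Definition weight (u : seq nat * seq nat) := sumn u.1 + sumn (map inner u.2).

(** The first condition is the one [plan_ok] puts on [p.1]; it is additive, so units can be combined
    freely. *)
Definition good_unit H (u : seq nat * seq nat) :=
  [&& odd (sumn u.1) == odd (size u.1), all (leq 1) u.1, all (leq 6) u.2,
      0 < weight u & weight u <= H].

Lemma innerP v : 6 <= v -> [/\ odd (inner v), 3 <= inner v, inner v + 2 <= v & v <= inner v + 3].
Proof. by rewrite /inner; case: ifP => o v6; split; lia. Qed.

Lemma inner_size vs : all (leq 6) vs -> 3 * size vs <= sumn (map inner vs) /\ all odd (map inner vs).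
Proof.
elim: vs => //= v vs IH /andP[/innerP[o h1 h2 h3] /IH[h ->]]; rewrite o.
by split=> //; move: h1 h; clear; lia.
Qed.

Lemma odd_ones n : sumn (nseq n 1) = n /\ all odd (nseq n 1).
Proof. by rewrite sumn_nseq mul1n; rewrite all_nseq orbT. Qed.

Lemma prefix_weight H us w : all (good_unit H) us -> w <= sumn (map weight us) ->
  exists us1 us2, [/\ us = us1 ++ us2, sumn (map weight us1) <= w
    & w <= sumn (map weight us1) + H].
Proof.
elim: us w => [|u us IH] w /=.
  by move=> _ w0; exists [::], [::]; split=> //=; move: w0; clear; lia.
case/andP=> gu gus sw; have /and5P[_ _ _ _ uH] := gu.
have [lw|wl] := leqP (weight u) w; last first.
  by exists [::], (u :: us); split=> //=; move: uH wl; clear; lia.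
have [|us1 [us2 [-> h1 h2]]] := IH (w - weight u) gus; first by move: sw lw; clear; lia.
by exists (u :: us1), us2; split=> //=; move: h1 h2 lw; clear; lia.
Qed.

Lemma units_flatten H us : all (good_unit H) us ->
  [/\ odd (sumn (flatten (map fst us))) = odd (size (flatten (map fst us))),
      all (leq 1) (flatten (map fst us)), all (leq 6) (flatten (map snd us))
    & sumn (map weight us) =
      sumn (flatten (map fst us)) + sumn (map inner (flatten (map snd us)))].
Proof.
elim: us => //= u us IH /andP[/and5P[/eqP o p v _ _] /IH[h1 h2 h3 h4]]; split.
- by rewrite sumn_cat size_cat !oddD o h1.
- by rewrite all_cat p.
- by rewrite all_cat v.
- by rewrite h4 sumn_cat map_cat sumn_cat /weight; clear; lia.
Qed.

(** A cycle of at most [H + 10] points is used up by crossing orbits with one point each. A longer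
    one takes whole units up to a gap, filled by such orbits; the gap is at least 3 because
    [seed_exchange] makes three of them. *)
Lemma pack_one H a us : 0 < a -> all (good_unit H) us -> a <= sumn (map weight us) ->
  exists us1 us2 N p, [/\ us = us1 ++ us2 /\ sumn (map weight us1) <= a, N <= H + 15,
    plan_ok (H + 10) a p, p.1 = flatten (map fst us1)
  & open_sizes p = map (fun v => (inner v).+1) (flatten (map snd us1)) ++ nseq N 2].
Proof.
move=> a0 gus sw; have [ath|ath] := leqP a (H + 10).
  exists [::], us, (a + odd a), ([::], nseq a 1); split=> //.
  - by move: ath; case: (odd a); clear; lia.
  - have [h1 h2] := odd_ones a.
    rewrite /plan_ok /= h1 h2 eqxx /= /seedable size_nseq leqnn ath /=.
    by case: (odd a).
  - by rewrite /open_sizes /= size_nseq map_nseq nseqD.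
have [|us1 [us2 [usE w1 w2]]] := @prefix_weight H us (a - 3) gus; first by move: sw; clear; lia.
have gus1 : all (good_unit H) us1 by move: gus; rewrite usE all_cat => /andP[].
have [o p v w] := units_flatten gus1.
set vs := flatten (map snd us1) in v w *; set M := flatten (map fst us1) in o p w *.
have [v1 v2] := inner_size v.
pose rho := a - sumn (map weight us1).
have rho3 : 3 <= rho <= H + 3 by rewrite /rho; move: w1 w2 ath; clear; lia.
pose c := size vs + rho.
have [h1 h2] := odd_ones rho.
exists us1, us2, (rho + odd c), (M, map inner vs ++ nseq rho 1); split=> //.
- by split=> //; move: w1; clear; lia.
- by case: (odd c) rho3; clear; lia.
- rewrite /plan_ok /= sumn_cat h1 all_cat h2 v2 o eqxx p /=; apply/andP; split.
    by rewrite addnA -w /rho; apply/eqP; move: w1; clear; lia.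
  rewrite /seedable size_cat size_map size_nseq -/c.
  (* As [a > H + 10] and [rho <= H + 3], the units weigh at least 8, and each piece among them
     brings one orbit for at least 3 inner points. *)
  have c2 : 3 <= c /\ c.+2 <= a.
    by rewrite /c /rho; move: w1 w2 v1 w ath; clear; lia.
  case: c2 => -> ca; rewrite ca orbT andbT; case: (odd c) => //=.
  by move: ca; clear; lia.
- by rewrite /open_sizes /= size_cat size_map size_nseq -/c map_cat -map_comp map_nseq nseqD catA.
Qed.

(** Each of the [N] open orbits of size 2 from [pack_one] is assigned an entry [h] of [hp] and gets
    its other [h - 2] points from the longest cycle; [H + 15] entries per short cycle suffice. *)
Lemma pack_all H as_ us hp : all (leq 1) as_ -> all (good_unit H) us ->
  sumn as_ <= sumn (map weight us) -> size as_ * (H + 15) <= size hp -> all (leq 2) hp ->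
  exists plans es us1 us2 hp1 hp2,
    [/\ us = us1 ++ us2 /\ hp = hp1 ++ hp2, all2 (plan_ok (H + 10)) as_ plans,
        perm_eq (flatten (map fst plans)) (flatten (map fst us1)),
        size es = size (flatten (map open_sizes plans))
      & perm_eq [seq p.1 + p.2 | p <- zip (flatten (map open_sizes plans)) es]
          (flatten (map snd us1) ++ hp1)].
Proof.
elim: as_ us hp => [|a as_ IH] us hp /=.
  by move=> *; exists [::], [::], [::], us, [::], hp.
case/andP=> a0 as0 gus sw shp h2.
have [|us1 [us2 [N [p [[usE w1] NH ok pM pO]]]]] := pack_one a0 gus; first by move: sw; clear; lia.
have [gus1 gus2] : all (good_unit H) us1 /\ all (good_unit H) us2.
  by move: gus; rewrite usE all_cat => /andP[].
have [|||plans [es [us3 [us4 [hp1 [hp2 [[usE2 hpE] oks pp sz pz]]]]]]] := IH us2 (drop N hp) as0 gus2.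
- by move: sw w1; rewrite usE map_cat sumn_cat; clear; lia.
- by rewrite size_drop; move: shp NH; rewrite mulSn; clear; lia.
- by move: h2; rewrite -{1}(cat_take_drop N hp) all_cat => /andP[].
have szN : size (take N hp) = N.
  by rewrite size_takel //; move: shp NH; rewrite mulSn; clear; lia.
have h2' : all (leq 2) (take N hp).
  by move: h2; rewrite -{1}(cat_take_drop N hp) all_cat => /andP[].
have [_ _ v6 _] := units_flatten gus1.
set vs := flatten (map snd us1) in v6 pO.
pose es1 := [seq v - (inner v).+1 | v <- vs] ++ [seq h - 2 | h <- take N hp].
have fE : flatten (map open_sizes (p :: plans)) = open_sizes p ++ flatten (map open_sizes plans) by [].
exists (p :: plans), (es1 ++ es), (us1 ++ us3), us4, (take N hp ++ hp1), hp2; split.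
- by rewrite usE usE2 -!catA -hpE cat_take_drop.
- by rewrite /= ok.
- by rewrite /= pM map_cat flatten_cat perm_cat2l.
- by rewrite fE pO /es1 !size_cat sz !size_map size_nseq szN.
rewrite fE pO zip_cat; last by rewrite /es1 !size_cat !size_map size_nseq szN.
rewrite map_cat map_cat flatten_cat /es1 zip_cat ?size_map // map_cat -/vs.
have -> : [seq q.1 + q.2 | q <- zip [seq (inner v).+1 | v <- vs] [seq v - (inner v).+1 | v <- vs]] = vs.
  elim: (vs) v6 => //= v vs' IHv /andP[/innerP[_ _ i2 _] /IHv ->]; congr cons.
  by move: i2; clear; lia.
have -> : [seq q.1 + q.2 | q <- zip (nseq N 2) [seq h - 2 | h <- take N hp]] = take N hp.
  rewrite -{1}szN; elim: (take N hp) h2' => //= h hs IHh /andP[i2 /IHh ->]; congr cons.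
  by move: i2; clear; lia.
move: pz; set Z := map _ _ => pz.
apply: (@perm_trans _ ((vs ++ take N hp) ++ (flatten (map snd us3) ++ hp1))).
  by rewrite perm_cat2l.
by rewrite -!catA perm_cat2l perm_catCA.
Qed.

Lemma plans_open theta as_ plans : all2 (plan_ok theta) as_ plans ->
  sumn (flatten (map fst plans)) + sumn (flatten (map open_sizes plans)) <=
    sumn as_ + 2 * size (flatten (map open_sizes plans)) /\
  sumn [seq theta + size p.2 + 10 | p : seq nat * seq nat <- plans] <=
    size as_ * (theta + 10) + size (flatten (map open_sizes plans)).
Proof.
elim: as_ plans => [|a as_ IH] [|[M rs] plans] //= /andP[/and5P[/= /eqP e _ _ _ _] /IH[h1 h2]].
have s1 : sumn (map succn rs) = sumn rs + size rs.
  by elim: (rs) => //= r rs' ->; clear; lia.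
rewrite /open_sizes /= !(sumn_cat, size_cat) s1 size_map size_nseq sumn_nseq /=.
rewrite -e -[map (fun p => map succn p.2 ++ _) _]/(map open_sizes plans).
set F := flatten (map open_sizes plans) in h1 h2 *; split.
  by move: h1; clear; lia.
rewrite (mulSn (size as_)); move: h2; clear; move: (size as_ * _) (sumn _) (size F) (size rs) => x y z w; lia.
Qed.

(** Two even parts together satisfy the parity condition on units, which one alone violates. *)
Lemma pair_even ev H : all (fun m => [&& 1 <= m, ~~ odd m & 2 * m <= H]) ev ->
  exists us left, [/\ perm_eq ev (flatten (map fst us) ++ left), all (good_unit H) us,
    flatten (map snd us) = [::] & size left <= 1].
Proof.
have [n] := ubnP (size ev); elim: n ev => // n IH [|x [|y ev]] sz h.
- by exists [::], [::].
- by exists [::], [:: x].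
move: h => /= /and3P[/and3P[x1 ox xH] /and3P[y1 oy yH] hev].
have [|us [left [h1 h2 h3 h4]]] := IH ev _ hev; first by move: sz => /=; clear; lia.
exists (([:: x; y], [::]) :: us), left; split=> //=.
  by rewrite !perm_cons.
rewrite h2 andbT /good_unit /weight /= x1 y1 addn0 addn0 oddD (negbTE ox) (negbTE oy) /=.
by move: x1 xH yH; clear; lia.
Qed.

(* sm and cuts are the parts not placed inside a single short cycle, those in cuts being
   divided into pieces; es and ms count the points each piece takes from the longest cycle
   beyond the orbits in [open_sizes]. *)
Definition allocates L as_ b mu plans sm cuts es ms :=
  [/\ all2 (plan_ok (6 * L + 10)) as_ plans,
      perm_eq mu (flatten (map fst plans) ++ sm ++ map sumn cuts),
      all (fun c : seq nat => odd (size c)) cuts,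
      size es = size (flatten (map open_sizes plans))
    & perm_eq (sm ++ flatten cuts)
        ([seq p.1 + p.2 | p <- zip (flatten (map open_sizes plans)) es] ++ ms)]
  /\ [/\ all (leq 1) ms,
      sumn [seq 6 * L + 10 + size p.2 + 10 | p : seq nat * seq nat <- plans] <= b
    & 2 * size es + 3 <= sumn es + sumn ms].

Lemma flatten_nseq1 as_ : flatten [seq nseq a 1 | a <- as_] = nseq (sumn as_) 1.
Proof. by elim: as_ => //= a as_ ->; rewrite nseqD. Qed.

Lemma not_leq2 s : all (leq 1) s -> filter (predC (leq 2)) s = nseq (count (predC (leq 2)) s) 1.
Proof.
elim: s => //= x s IH /andP[x1 /IH ->]; case: ltnP => //= x2; congr cons.
by move: x1 x2; clear; lia.
Qed.

(* With few parts of size at least 2, every cycle other than the longest is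
   filled with fixed points. *)
Lemma allocation_fixed_points L as_ b mu sm cuts :
  all (leq 1) mu -> perm_eq mu (sm ++ map sumn cuts) ->
  all (fun p => p < 3 * L) sm -> all (fun c => odd (size c)) cuts ->
  all (fun v => L <= v < 3 * L) (flatten cuts) -> 0 < L ->
  sumn mu = sumn as_ + b ->
  (count (leq 2) sm + size (flatten cuts)) * (3 * L) + size as_ * (6 * L + 10 + 10) + 3 <= b ->
  exists plans sm' es ms, allocates L as_ b mu plans sm' cuts es ms.
Proof.
move=> mu1 pmu sm3 oc c3 L0 smu hb.
have sm1 : all (leq 1) sm by move: mu1; rewrite (perm_all _ pmu) all_cat => /andP[].
pose big := filter (leq 2) sm; pose o := count (predC (leq 2)) sm.
have psm : perm_eq sm (big ++ nseq o 1).
  by rewrite -not_leq2 // perm_sym /big; apply/permPl/perm_filterC.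
have sbig : sumn big <= 3 * L * count (leq 2) sm.
  rewrite -size_filter; apply: sumn_leq_size; rewrite all_filter.
  by apply: sub_all sm3 => p; rewrite /= => /ltnW ->; rewrite implybT.
have svv : sumn (flatten cuts) <= 3 * L * size (flatten cuts).
  by apply: sumn_leq_size; apply: sub_all c3 => v /andP[_ /ltnW].
have ssm : sumn sm = sumn big + o by rewrite (perm_sumn psm) sumn_cat sumn_nseq mul1n.
have smu2 : sumn mu = sumn sm + sumn (flatten cuts).
  by rewrite (perm_sumn pmu) sumn_cat sumn_flatten.
(* Pieces and parts of size at least 2 cover no more points than the longest cycle has, so the fixed
   points suffice for all the others. *)
have oas : sumn as_ <= o.
  move: hb; rewrite mulnDl; move: sbig svv ssm smu2 smu; clear.
  by rewrite !(mulnC (3 * L)); move: (count _ _ * _) (size _ * (3 * L)) (size as_ * _); lia.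
pose plans := [seq (nseq a 1, [::] : seq nat) | a <- as_].
have oE : flatten (map open_sizes plans) = [::] by rewrite /plans; elim: (as_).
have fE : flatten (map fst plans) = nseq (sumn as_) 1 by rewrite -flatten_nseq1 /plans -map_comp.
pose sm' := big ++ nseq (o - sumn as_) 1.
have psm' : perm_eq sm (nseq (sumn as_) 1 ++ sm').
  apply: perm_trans psm _; rewrite /sm' perm_sym perm_catCA perm_cat2l -nseqD subnKC //.
exists plans, sm', [::], (sm' ++ flatten cuts); rewrite /allocates oE fE; split; split=> //.
- rewrite /plans; elim: (as_) => //= a as' ->.
  have [h1 _] := odd_ones a.
  by rewrite /plan_ok /= h1 addn0 eqxx size_nseq eqxx all_nseq orbT /seedable /=.
- by apply: perm_trans pmu _; rewrite catA perm_cat2r.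
- rewrite all_cat; apply/andP; split.
    by move: sm1; rewrite (perm_all _ psm') all_cat => /andP[].
  by apply: sub_all c3 => v /andP[Lv _]; apply: leq_trans Lv.
- rewrite /plans -map_comp (_ : sumn _ = size as_ * (6 * L + 10 + 10)).
    exact: leq_trans (leq_trans (leq_addl _ _) (leq_addr _ _)) hb.
  by elim: (as_) => //= a as' ->; rewrite mulSn addn0.
- rewrite /= muln0 !add0n sumn_cat; have := perm_sumn psm'; rewrite sumn_cat sumn_nseq mul1n.
  move: smu smu2 hb; clear.
  by move: (_ * (3 * L)) (size as_ * _); lia.
Qed.

Lemma take_parts N (s1 s2 : seq nat) : N <= size s1 + size s2 ->
  exists h1 r1 h2 r2, [/\ s1 = h1 ++ r1, s2 = h2 ++ r2 & size h1 + size h2 = N].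
Proof.
move=> h; exists (take N s1), (drop N s1), (take (N - size s1) s2), (drop (N - size s1) s2).
by rewrite !cat_take_drop !size_take_min; split=> //; lia.
Qed.

Lemma allocation L as_ b mu : 6 <= L -> 40 * (size as_).+1 <= L ->
  all (leq 1) as_ -> all (leq 1) mu -> sumn mu = sumn as_ + b ->
  sumn mu <= (size as_).+1 * b ->
  8 * (size as_ * (6 * L + 15) * (3 * L) + 3 * L + size as_ * (6 * L + 10 + 10) + 3) <= b ->
  exists plans sm cuts es ms, allocates L as_ b mu plans sm cuts es ms.
Proof.
move=> L6 L40 as1 mu1 smu mub hb.
have [|sm [cuts [pmu sm3 oc c3]]] := @cut_all L mu _; first by apply: leq_trans L6.
set N := size as_ * (6 * L + 15) in hb.
have NE : size as_ * (6 * L + 15) = N by [].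
clearbody N.
set vv := flatten cuts in c3.
have svv : L * size vv <= sumn vv by apply: leq_sumn_size; apply: sub_all c3 => v /andP[].
have smu2 : sumn mu = sumn sm + sumn vv by rewrite (perm_sumn pmu) sumn_cat sumn_flatten.
(* Each piece has at least [L >= 40 * (size as_).+1] points, out of at most [(size as_).+1 * b]. *)
have nV : 40 * size vv <= b.
  rewrite -(leq_pmul2l (ltn0Sn (size as_))) mulnCA mulnA; apply: leq_trans mub.
  apply: leq_trans (leq_mul L40 (leqnn _)) _; rewrite smu2.
  exact: leq_trans svv (leq_addl _ _).
(* [N] entries of size at least 2 are reserved to complete the open orbits of size 2; if fewer
   exist, nearly all points are fixed by [t]. *)
have [few|many] := ltnP (count (leq 2) sm + size vv) N.
  have [||plans [sm' [es [ms h]]]] := allocation_fixed_points mu1 pmu sm3 oc c3 _ smu; last first.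
  - by exists plans, sm', cuts, es, ms.
  - apply: leq_trans hb; rewrite -/vv.
    have := leq_mul (ltnW few) (leqnn (3 * L)).
    by move: (_ * (3 * L)) (N * (3 * L)) (size as_ * _); clear; lia.
  - by apply: leq_trans L6.
have sm1 : all (leq 1) sm by move: mu1; rewrite (perm_all _ pmu) all_cat => /andP[].
have [|hs [rs [hv [rv [hsE hvE szh]]]]] := @take_parts N (filter (leq 2) sm) vv.
  by rewrite size_filter.
pose smr := rs ++ filter (predC (leq 2)) sm.
have psm : perm_eq sm (hs ++ smr).
  by rewrite /smr catA -hsE perm_sym; apply/permPl/perm_filterC.
have smr1 : all (leq 1) smr by move: sm1; rewrite (perm_all _ psm) all_cat => /andP[].
have smr3 : all (fun p => p < 3 * L) smr by move: sm3; rewrite (perm_all _ psm) all_cat => /andP[].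
pose od := filter odd smr; pose ev := filter (predC odd) smr.
have [|us0 [left [pev gus0 us0V szl]]] := @pair_even ev (6 * L).
  rewrite all_filter; apply/allP=> p pS; have := allP smr1 p pS; have := allP smr3 p pS.
  by rewrite /=; case: (odd p) => //=; clear; lia.
pose us := [seq ([:: m], [::]) | m <- od] ++ us0 ++ [seq ([::], [:: v]) | v <- rv].
have rvL : all (fun v => L <= v < 3 * L) rv by move: c3; rewrite hvE all_cat => /andP[].
have hvL : all (fun v => L <= v < 3 * L) hv by move: c3; rewrite hvE all_cat => /andP[].
have gus : all (good_unit (6 * L)) us.
  rewrite /us !all_cat gus0; apply/and3P; split=> //.
    rewrite all_map all_filter; apply/allP=> p pS; apply/implyP=> op.
    have := allP smr1 p pS; have := allP smr3 p pS; rewrite /= /good_unit /weight /= !addn0 op eqxx /=.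
    by move=> p3 p1; rewrite p1 /=; move: p3; clear; lia.
  rewrite all_map; apply/allP=> v /(allP rvL) /andP[vL v3].
  have v6 : 6 <= v by apply: leq_trans vL.
  have [_ i3 _ _] := innerP v6.
  rewrite /= /good_unit /weight /= v6 add0n addn0.
  move: (inner v) (innerP v6) v3 => i [_ h1 h2 _]; clear -h1 h2 => v3.
  by move: h1 h2 v3; clear; lia.
have usM : perm_eq (smr) (flatten (map fst us) ++ left).
  rewrite /us !map_cat !flatten_cat -!map_comp.
  have -> : flatten [seq [:: m] | m <- od] = od by rewrite flatten_map1 map_id.
  have -> : flatten [seq (fst \o (fun v : nat => ([::] : seq nat, [:: v]))) v | v <- rv] = [::] by elim: (rv).
  rewrite cats0 -catA; apply: perm_trans (_ : perm_eq _ (od ++ ev)) _.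
    by rewrite perm_sym; apply/permPl/perm_filterC.
  by rewrite perm_cat2l.
have usV : flatten (map snd us) = rv.
  rewrite /us !map_cat !flatten_cat -!map_comp us0V.
  have -> : flatten [seq (snd \o (fun m : nat => ([:: m], [::] : seq nat))) v | v <- od] = [::] by elim: (od).
  by rewrite /= flatten_map1 map_id.
have [_ _ _ wus] := units_flatten gus; rewrite usV in wus.
have le3 : all (fun x => x <= 3 * L) (hs ++ hv ++ left).
  rewrite !all_cat; apply/and3P; split.
  - have : all (fun p => p < 3 * L) hs by move: sm3; rewrite (perm_all _ psm) all_cat => /andP[].
    by apply: sub_all => p /ltnW.
  - by apply: sub_all hvL => p /andP[_ /ltnW].
  move: smr3; rewrite (perm_all _ usM) all_cat => /andP[_].
  by apply: sub_all => p /ltnW.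
have sle3 := sumn_leq_size le3.
have sin : sumn rv <= sumn (map inner rv) + 3 * size rv.
  elim: (rv) rvL => //= v rv' IH /andP[/andP[vL _] /IH h].
  have [_ _ _ i3] := innerP (leq_trans L6 vL).
  by move: h i3; clear; lia.
have ssm := perm_sumn psm; rewrite sumn_cat in ssm.
have ssmr := perm_sumn usM; rewrite sumn_cat in ssmr.
have svv2 : sumn vv = sumn hv + sumn rv by rewrite hvE sumn_cat.
have nvv : size vv = size hv + size rv by rewrite hvE size_cat.
have n3 : 3 * L * size (hs ++ hv ++ left) <= N * (3 * L) + 3 * L.
  by rewrite !size_cat addnA szh mulnDr (mulnC _ N) leq_add2l -[X in _ <= X]muln1 leq_mul2l szl orbT.
(* The units miss only the [N] reserved entries, at most one unpaired even part, and at most 3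
   points per piece, in all fewer than [b] points. *)
have wbound : sumn as_ <= sumn (map weight us).
  rewrite !sumn_cat in sle3; move: wus sle3 sin ssm ssmr svv2 nvv n3 smu smu2 nV hb; clear.
  by move: (3 * L) => t; move: (N * t) (t * _) (size as_ * _); lia.
have shp : size as_ * (6 * L + 15) <= size (hs ++ hv) by rewrite size_cat szh NE.
have hp2 : all (leq 2) (hs ++ hv).
  rewrite all_cat; apply/andP; split; last first.
    by apply: sub_all hvL => v /andP[vL _]; apply: leq_trans vL; apply: leq_trans L6.
  have : all (leq 2) (filter (leq 2) sm) by apply: filter_all.
  by rewrite hsE all_cat => /andP[].
have [plans [es [us1 [us2 [hp1 [hp3 [[usE hpE] ok pM sz pz]]]]]]] := pack_all as1 gus wbound shp hp2.
have [po1 po2] := plans_open ok.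
set bs := flatten (map open_sizes plans) in sz pz po1 po2 *.
have szes : size es <= size vv + N.
  have := perm_size pz; rewrite size_map size_zip -sz minnn size_cat => ->.
  have h1 : size rv = size (flatten (map snd us1)) + size (flatten (map snd us2)).
    by rewrite -usV usE map_cat flatten_cat size_cat.
  have h2 : size hs + size hv = size hp1 + size hp3 by rewrite -!size_cat hpE.
  rewrite nvv; move: h1 h2 szh; clear; move: (size (flatten (map snd us1))) (size (flatten (map snd us2))) (size hv) (size rv) (size hs) (size hp1) (size hp3); lia.
pose M2 := flatten (map fst us2).
have usM' : perm_eq smr (flatten (map fst plans) ++ M2 ++ left).
  apply: perm_trans usM _; rewrite usE map_cat flatten_cat -catA perm_cat2r.
  by rewrite perm_sym.
pose ms := left ++ M2 ++ flatten (map snd us2) ++ hp3.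
have pparts : perm_eq ((hs ++ left ++ M2) ++ vv)
    ([seq p.1 + p.2 | p <- zip bs es] ++ ms).
  apply/seq.permP => a; have e1 := seq.permP pz a; have e2 := congr1 (count a) hpE.
  have e3 : count a rv = count a (flatten (map snd us1)) + count a (flatten (map snd us2)).
    by rewrite -usV usE map_cat flatten_cat count_cat.
  move: e1 e2; rewrite /ms hvE !count_cat => -> e2; rewrite e3.
  by move: e2; clear; lia.
have pall : perm_eq mu (flatten (map fst plans) ++ (hs ++ left ++ M2) ++ map sumn cuts).
  apply/seq.permP => a; rewrite (seq.permP pmu) !count_cat (seq.permP psm) count_cat (seq.permP usM') !count_cat.
  by clear; lia.
have sumzip : sumn [seq p.1 + p.2 | p <- zip bs es] = sumn bs + sumn es.
  elim: (bs) (es) sz => [|b1 bs' IH] [|e es'] //= [/IH ->]; by clear; lia.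
exists plans, (hs ++ left ++ M2), cuts, es, ms; split; split=> //.
- rewrite /ms -/(all _ _) !all_cat; move: smr1; rewrite (perm_all _ usM') !all_cat => /and3P[_ -> ->] /=.
  apply/andP; split.
    have : all (fun v => L <= v < 3 * L) rv := rvL.
    rewrite -usV usE map_cat flatten_cat all_cat => /andP[_].
    by apply: sub_all => v /andP[vL _]; apply: leq_trans vL; apply: leq_trans L6.
  by move: hp2; rewrite hpE all_cat => /andP[_]; apply: sub_all => h; apply: ltnW.
- apply: leq_trans po2 _; rewrite -sz; have L3 : 1 <= 3 * L by move: L6; clear; lia.
  have := leq_mul (leqnn N) L3; move: szes nV hb; clear.
  by move: (3 * L) => t; move: (N * t) (size as_ * _); lia.
have L3 : 1 <= 3 * L by move: L6; clear; lia.
have NL := leq_mul (leqnn N) L3; rewrite muln1 in NL.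
have := perm_sumn pparts; rewrite [in X in _ = X]sumn_cat sumzip !sumn_cat.
have := perm_sumn pall; rewrite !sumn_cat -sumn_flatten -/vv.
rewrite -sz in po1; move: smu po1 szes nV hb NL; clear.
by move: (3 * L) => t; move: (N * t) (size as_ * _); lia.
Qed.

(** * The theorem *)

Lemma cycrepV (T : finType) (s : {perm T}) ss : cycrep s ss -> cycrep s^-1 (map rev ss).
Proof.
case/and3P=> p n a; apply/and3P; split.
- apply: perm_trans p; elim: (ss) => //= l ss' IH.
  by apply: perm_cat => //; rewrite perm_rev.
- apply: contra n => /mapP[l ls e]; rewrite (_ : [::] = l) //.
  by apply/esym/size0nil; rewrite -size_rev -e.
apply/allP=> _ /mapP[l ls ->]; rewrite rev_cycle.
rewrite (eq_cycle (e' := frel s)); first exact: (allP a).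
by move=> x y /=; rewrite -(inj_eq (@perm_inj _ s)) permKV eq_sym.
Qed.

Lemma longest_cycle (A : eqType) (ss : seq (seq A)) : 0 < size ss ->
  exists l ls, perm_eq ss (l :: ls) /\ all (fun m => size m <= size l) (l :: ls).
Proof.
elim: ss => // l [|m ss] IH _; first by exists l, [::]; rewrite /= leqnn.
have [//|k [ks [p h]]] := IH _.
have p2 : perm_eq [:: l, m & ss] [:: l, k & ks] by rewrite perm_cons.
have [lk|kl] := leqP (size l) (size k).
  exists k, (l :: ks); split.
    by apply: perm_trans p2 _; rewrite -cat1s -[k :: _]cat1s perm_catCA.
  by move: h => /= /andP[-> ->]; rewrite lk.
exists l, (k :: ks); split=> //=; rewrite leqnn (ltnW kl) /=.
by move: h => /= /andP[_]; apply: sub_all => m' h'; apply: leq_trans h' (ltnW kl).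
Qed.

Lemma sumn_cycrep (T : finType) (s : {perm T}) ss : cycrep s ss -> sumn (map size ss) = #|T|.
Proof. by case/and3P=> /perm_size; rewrite size_flatten /shape cardE. Qed.

Lemma cycrep_pos (T : finType) (s : {perm T}) ss : cycrep s ss -> all (leq 1) (map size ss).
Proof.
case/and3P=> _ n _; rewrite all_map; apply/allP=> l ls /=; rewrite lt0n size_eq0.
by apply: contraNneq n => <-.
Qed.

Lemma even_in_square n (s t : 'S_n) : 0 < n -> 500 * 500 * cyc s ^ 4 <= n -> ~~ odd_perm t ->
  t \in (conj_class s * conj_class s)%g.
Proof.
move=> n0 hn ot.
have [ss rs sz] := cycrep_exists s; have [tt rt _] := cycrep_exists t.
have ss0 : 0 < size ss.
  by have := sumn_cycrep rs; rewrite card_ord; case: (ss) => //= e; rewrite -e in n0.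
have [B [As [p maxB]]] := longest_cycle ss0.
have rs' : cycrep s (B :: As) by rewrite -(cycrep_perm _ p).
have szAs : (size As).+1 = cyc s by rewrite /cyc -sz (perm_size p).
pose L := 40 * cyc s.
have sumB := sumn_cycrep rs'; rewrite card_ord /= in sumB.
have sumt := sumn_cycrep rt; rewrite card_ord in sumt.
(* The longest cycle has at least the average length; this is where the cube becomes a fourth
   power. *)
have nB : n <= cyc s * size B.
  rewrite -[X in X <= _]sumB -szAs mulnC; have := @sumn_leq_size (size B) (map size (B :: As)).
  by rewrite all_map size_map => ->.
have k0 : 0 < cyc s by rewrite -szAs.
have bB : 500 * 500 * cyc s ^ 3 <= size B.
  by rewrite -(leq_pmul2l k0) mulnCA -expnS; apply: leq_trans nB.
have [||||||| plans [sm [cuts [es [ms [[h1 h2 h3 h4 h5] [h6 h7 h8]]]]]]] :=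
  @allocation L (map size As) (size B) (map size tt).
- by rewrite /L; move: k0; clear; lia.
- by rewrite size_map szAs.
- by have := cycrep_pos rs' => /= /andP[].
- exact: cycrep_pos rt.
- by rewrite sumt -[LHS]sumB addnC.
- by rewrite sumt size_map szAs.
- apply: leq_trans bB; rewrite size_map /L -szAs; clear.
  by move: (size As) => k; nia.
have [|u [[g ug] [h uh]]] := realize rs' rt ot _ h2 h3 h4 h5 h6 h7 h8.
  elim: (As) (plans) h1 => [|A As' IH] [|q qs] //= /andP[-> /IH]; exact.
(* Reversing the cycles of [s] gives those of [s^-1]. *)
have [w sV] : exists w, (s^-1 = s ^ w)%g.
  apply: cycrep_conj rs' (cycrepV rs') _.
  by rewrite -map_comp (eq_map (g := size)) // => l /=; rewrite size_rev.
have tE : t = ((s ^ (w * g^-1)) * (s ^ (h * g^-1)))%g.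
  rewrite !conjgM -conjMg -sV -uh mulKg ug conjgK //.
rewrite tE; apply: mem_mulg; apply/imsetP; by eexists; rewrite ?inE //.
Qed.

Lemma conj_class_square n (s : 'S_n) : 0 < n -> 500 * 500 * cyc s ^ 4 <= n ->
  (conj_class s * conj_class s = 'Alt_('I_n))%g.
Proof.
move=> n0 hn; apply/setP=> t; rewrite Alt_even; apply/idP/idP; last exact: even_in_square.
case/mulsgP=> _ _ /imsetP[x _ ->] /imsetP[y _ ->] ->.
by rewrite odd_permM !odd_permJ addbb.
Qed.

(* The real number n^(1/128) is the nonnegative 128-th root of n in algC. *)
Theorem theorem1p1 :
  (forall k : nat, (0 < k)%N ->
     exists f : nat, forall (n : nat) (s : 'S_n),
       (f <= n)%N -> (cyc s <= k)%N ->
       (conj_class s * conj_class s = 'Alt_('I_n))%g)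
  /\
  (exists c : nat, forall (n : nat) (s : 'S_n),
     (c <= n)%N -> ((cyc s)%:R <= 128.-root (n%:R : algC))%R ->
     (conj_class s * conj_class s = 'Alt_('I_n))%g).
Proof.
split=> [k k0|].
  exists (500 * 500 * k ^ 4) => n s hn hk.
  have n0 : 0 < n by apply: leq_trans hn; rewrite muln_gt0 expn_gt0 k0.
  apply: conj_class_square => //; apply: leq_trans hn.
  by rewrite leq_mul2l leq_exp2r // hk orbT.
(* Then [500 * 500] is at most the square root of [n], and so is [cyc s ^ 4], because
   [cyc s ^ 8 <= cyc s ^ 128 <= n]; the comparison is made between squares. *)
exists ((500 * 500) ^ 2) => n s hn hs.
have n0 : 0 < n by apply: leq_trans hn; rewrite expn_gt0.
have {}hs : cyc s ^ 128 <= n.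
  rewrite -(ler_nat algC) natrX -[(n%:R)%R](@rootCK algC 128) //.
  by apply: lerXn2r; rewrite ?nnegrE ?ler0n // rootC_ge0 // ler0n.
apply: conj_class_square => //; rewrite -leq_sqr expnMn -expnM [n ^ 2]expnS expn1.
apply: leq_mul => //; apply: leq_trans hs.
by case: (posnP (cyc s)) => [->|k0] //; rewrite leq_pexp2l.
Qed.
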